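(* Let $q$ be an odd prime power, let $n\ge 3$ be an integer, and let $f(x,y,z)=x(y+z)$ be viewed as a function from $SL_n(\mathbb{F}_q)\times SL_n(\mathbb{F}_q)\times M_n(\mathbb{F}_q)$ to $M_n(\mathbb{F}_q)$. There are constants $C_0,c>0$ (independent of $q$ and the sets) such that for all $A,B\subset SL_n(\mathbb{F}_q)$ and $C\subset M_n(\mathbb{F}_q)$ with $|B|\ge C_0 q^{n^2-2}$ and $|C|\ge C_0 q^{(n-1)^2}$, \[ |f(A,B,C)| \ge c\,\min\left\{ q^{n^2},\; \frac{|A||B|^2|C|}{q^{3n^2-3n-2}},\; \frac{|A||B|}{q^{n^2-n-1}}\right\}.\]
   Context: $M_n(\mathbb{F}_q)$ is the ring of $n\times n$ matrices over $\mathbb{F}_q$, $SL_n(\mathbb{F}_q)$ the matrices of determinant $1$, and $f(A,B,C)=\{a(b+c): a\in A,b\in B,c\in C\}$. *)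

(* Defs.v *)
From mathcomp Require Import all_boot all_order all_algebra.
From mathcomp Require Import reals.

Set Implicit Arguments.
Unset Strict Implicit.
Unset Printing Implicit Defensive.

Import GRing.Theory.
Local Open Scope ring_scope.

(* The ambient set of matrices of determinant 1; it is a plain set of matrices,
   rather than a subgroup of 'GL_n[F], since its elements are also added. *)
Definition SLn (F : finFieldType) (n : nat) : {set 'M[F]_n} :=
  [set M : 'M[F]_n | \det M == 1].

Definition f (F : finFieldType) (n : nat) (x y z : 'M[F]_n) : 'M[F]_n :=
  x *m (y + z).

Definition fset_image (F : finFieldType) (n : nat) (A B C : {set 'M[F]_n}) :
    {set 'M[F]_n} :=
  [set f t.1.1 t.1.2 t.2 | t in setX (setX A B) C].

(* Main.v *)
Require Import Defs.
From mathcomp Require Import all_boot all_order all_algebra.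
From mathcomp Require Import all_fingroup all_field all_character.
From mathcomp Require Import ring zify lra.
From mathcomp Require Import reals.

Set Implicit Arguments.
Unset Strict Implicit.
Unset Printing Implicit Defensive.

Import Order.TTheory GRing.Theory Num.Theory.
Local Open Scope ring_scope.

(* Let [r d] be the number of pairs [(b, c)] with [b + c = d], restricted to
   invertible [d], and let [P] be its sum over [d]. By Cauchy-Schwarz,
   [(|A| P) ^ 2 <= |f(A, B, C)| E] with [E = \sum_s (\sum_(a in A) r (a^-1 s)) ^ 2].
   Convolution on SL_n is quasirandom: the nontrivial characters of the group of
   transvections acting on one row are permuted transitively by the normaliser
   of that group, so averaging over the group costs only a term with the factor
   [|SL_n| / (q ^ (n - 1) - 1)], and boundedly many such averages over various
   rows dominate the mean over SL_n. Hence [E] is at most a mean term, which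
   counts solutions of [\det (b + c) = \det (b' + c') != 0], plus about
   [q ^ (n ^ 2 - n) |A| \sum_d r d ^ 2]. Both counts come from additive Fourier
   analysis on matrices: if [gamma] has sum zero and vanishes at 0, the transform
   of [gamma \o \det] vanishes at singular matrices and is constant on SL_n-orbits,
   so Plancherel bounds its square by [q ^ (n ^ 2) \sum_t |gamma t| ^ 2]. *)

(** * Characters and Plancherel on matrix spaces *)

(** No representation theory of SL_n enters: the nontrivial frequencies of one row's transvections
    form a single orbit and carry equal mass, so each holds at most a fraction
    [1 / (q ^ (n - 1) - 1)] of a Plancherel total. The obstacle is uniformity in [q] when rows are
    combined. Since the determinant condition ties the rows together, averages over different rows
    do not compose exactly. All functions involved are nonnegative, however, so it suffices to bound
    the kernel of a composition pointwise by a constant times the kernel of a coarser average. This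
    reduces quasirandomness to counting paths of matrices with prescribed rows. Singular sums are
    discarded because [h SL_n] is a full level set of the determinant exactly when [h] is
    invertible; the size of [B] ensures that at least half of the pairs survive. In both energy
    counts the representation function is itself fed into the mixing bound, so the unknown occurs on
    both sides, as in [(a - y) ^ 2 <= M * a], and is then solved for. *)

Lemma cauchy_schwarz_real (R : numDomainType) (I : finType) (x y : I -> R) :
  (forall i, x i \is Num.real) -> (forall i, y i \is Num.real) ->
  (\sum_i x i * y i) ^+ 2 <= (\sum_i x i ^+ 2) * (\sum_i y i ^+ 2).
Proof.
move=> xr yr; rewrite -subr_ge0 -(@pmulrn_lge0 _ _ 2) //.
(* Lagrange's identity. *)
suff -> : ((\sum_i x i ^+ 2) * (\sum_i y i ^+ 2) - (\sum_i x i * y i) ^+ 2) *+ 2 =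
    \sum_i \sum_j (x i * y j - x j * y i) ^+ 2.
  apply: sumr_ge0 => i _; apply: sumr_ge0 => j _.
  by rewrite real_exprn_even_ge0 // rpredB // rpredM.
have e1 : \sum_i \sum_j x i ^+ 2 * y j ^+ 2 = (\sum_i x i ^+ 2) * (\sum_i y i ^+ 2).
  by rewrite big_distrlr.
have e2 : \sum_i \sum_j x j ^+ 2 * y i ^+ 2 = (\sum_i x i ^+ 2) * (\sum_i y i ^+ 2).
  by rewrite exchange_big.
have e3 : \sum_i \sum_j (x i * y i) * (x j * y j) = (\sum_i x i * y i) ^+ 2.
  by rewrite -big_distrlr.
rewrite mulrnBl mulr2n -{1}e1 -e2 -e3 -big_split -sumrMnl -sumrB.
apply: eq_bigr => i _; rewrite -big_split -sumrMnl -sumrB.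
by apply: eq_bigr => j _ /=; ring.
Qed.

Lemma cauchy_schwarz (R : numFieldType) (I : finType) (x y : I -> R) :
  `|\sum_i x i * y i| ^+ 2 <= (\sum_i `|x i| ^+ 2) * (\sum_i `|y i| ^+ 2).
Proof.
have := @cauchy_schwarz_real R I (fun i => `|x i|) (fun i => `|y i|).
move/(_ (fun i => normr_real _) (fun i => normr_real _)); apply: le_trans.
rewrite lerXn2r ?nnegrE ?normr_ge0 ?sumr_ge0 // => [i _|]; first by rewrite mulr_ge0.
by apply: le_trans (ler_norm_sum _ _ _) _; apply: ler_sum => i _; rewrite normrM.
Qed.

(** A nonprincipal irreducible character of the additive group is linear because the group is
    abelian. Translation by a point where it differs from 1 multiplies its total sum by a factor
    other than 1, so the sum vanishes. *)
Lemma nontrivial_additive_character (F : finFieldType) :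
  exists chi : F -> algC, [/\ chi 0 = 1, forall x y, chi (x + y) = chi x * chi y,
    forall x, chi (- x) = (chi x)^* & \sum_x chi x = 0].
Proof.
have ab : abelian [set: F]%G.
  by apply/centsP => x _ y _; rewrite /commute; apply: addrC.
have nI : (1 < #|Iirr [set: F]%G|)%N.
  rewrite card_Iirr_abelian // cardsT; exact: finNzRing_gt1.
have [i ni] : exists i : Iirr [set: F]%G, i != 0.
  case/card_gt1P: nI => i [j [_ _ ij]].
  by case: (eqVneq i 0) ij => [->|]; [exists j; rewrite eq_sym|exists i].
have li : 'chi_i \is a linear_char by apply/char_abelianP.
have hM x y : 'chi_i (x + y) = 'chi_i x * 'chi_i y.
  by apply: (lin_charM li); rewrite inE.
exists 'chi_i; split => //.
  by rewrite (lin_char1 li).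
  by move=> x; rewrite -lin_charV_conj ?inE.
have [x0 hx0] : exists x, 'chi_i x != 1.
  apply/existsP; move: ni; rewrite -irr_eq1; apply: contraNT.
  rewrite negb_exists => /forallP h; apply/eqP/cfunP => x.
  by rewrite cfun1E inE; move/negPn/eqP: (h x).
apply/eqP; rewrite -[_ == 0](@mulrI_eq0 _ ('chi_i x0 - 1)); last first.
  by apply/lregP; rewrite subr_eq0.
rewrite mulrBl mul1r subr_eq0; apply/eqP; rewrite big_distrr /=.
rewrite [RHS](reindex_inj (addrI x0)) /=.
by apply: eq_bigr => x _; rewrite hM.
Qed.

Lemma mxtrace_delta (R : pzRingType) m p (i : 'I_p) (j : 'I_m) (x : 'M[R]_(m, p)) :
  \tr (delta_mx i j *m x) = x j i.
Proof.
rewrite /mxtrace (bigD1 i) //= big1 ?addr0 => [|k ki].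
  rewrite mxE (bigD1 j) //= big1 ?addr0 ?mxE ?eqxx ?mul1r // => l lj.
  by rewrite mxE (negPf lj) andbF mul0r.
by rewrite mxE big1 // => l _; rewrite mxE (negPf ki) mul0r.
Qed.

Section Fourier.
Variables (F : finFieldType) (chi : F -> algC).
Hypothesis chi0 : chi 0 = 1.
Hypothesis chiD : forall x y, chi (x + y) = chi x * chi y.
Hypothesis chiN : forall x, chi (- x) = (chi x)^*.
Hypothesis sum_chi : \sum_x chi x = 0.
Local Notation q := (#|F|).

(** The trace pairing is nondegenerate: a multiple of a [delta_mx] at a nonzero entry of [x] makes
    the trace any prescribed scalar, and translating by it kills the sum. *)
Lemma sum_chi_trace m p (x : 'M[F]_(m, p)) :
  \sum_(z : 'M_(p, m)) chi (\tr (z *m x)) = (x == 0)%:R * q%:R ^+ (m * p).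
Proof.
case: eqVneq => [->|nx].
  rewrite mul1r (eq_bigr (fun=> 1)) => [|z _]; last by rewrite mulmx0 mxtrace0.
  by rewrite sumr_const card_mx mulnC natrX.
have [t0 ht0] : exists t, chi t != 1.
  apply/existsP; move/eqP: sum_chi; apply: contraTT.
  rewrite negb_exists => /forallP h.
  rewrite (eq_bigr (fun=> 1)) => [|x' _]; last by apply/eqP/negPn/h.
  by rewrite sumr_const pnatr_eq0 -lt0n; apply/card_gt0P; exists 0.
have [j [i nji]] : exists j i, x j i != 0.
  have /existsP[j /existsP[i h]] : [exists j, [exists i, x j i != 0]].
    apply: contraNT nx; rewrite negb_exists => /forallP h; apply/eqP/matrixP => j i.
    by move: (h j); rewrite negb_exists => /forallP/(_ i); rewrite negbK mxE => /eqP.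
  by exists j, i.
pose z0 : 'M_(p, m) := (t0 / x j i) *: delta_mx i j.
have hz0 : \tr (z0 *m x) = t0.
  by rewrite -scalemxAl mxtraceZ mxtrace_delta divfK.
rewrite mul0r; apply/eqP; rewrite -[_ == 0](@mulrI_eq0 _ (chi t0 - 1)); last first.
  by apply/lregP; rewrite subr_eq0.
rewrite mulrBl mul1r subr_eq0; apply/eqP; rewrite big_distrr /=.
rewrite [RHS](reindex_inj (addrI z0)) /=.
by apply: eq_bigr => z _; rewrite mulmxDl mxtraceD hz0 chiD.
Qed.

(** The dual variable has the transposed shape, so that a factor multiplying [x] moves to [z] by
    cyclicity of the trace. *)
Definition fourier m p (g : 'M[F]_(m, p) -> algC) (z : 'M_(p, m)) : algC :=
  \sum_x g x * chi (\tr (z *m x)).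

Lemma chi_traceN m p (z : 'M[F]_(p, m)) (x : 'M[F]_(m, p)) :
  chi (\tr (z *m - x)) = (chi (\tr (z *m x)))^*.
Proof. by rewrite mulmxN raddfN chiN. Qed.

Lemma plancherel m p (g : 'M[F]_(m, p) -> algC) :
  \sum_z `|fourier g z| ^+ 2 = q%:R ^+ (m * p) * \sum_x `|g x| ^+ 2.
Proof.
transitivity (\sum_x \sum_y \sum_(z : 'M_(p, m))
    g x * (g y)^* * chi (\tr (z *m (x - y)))).
  rewrite (eq_bigr (fun z => \sum_x \sum_y
      g x * (g y)^* * chi (\tr (z *m (x - y))))) => [|z _].
    by rewrite exchange_big; apply: eq_bigr => x _; rewrite exchange_big.
  rewrite normCK rmorph_sum big_distrlr; apply: eq_bigr => x _.
  apply: eq_bigr => y _; rewrite rmorphM mulmxDr mxtraceD chiD chi_traceN /=.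
  by rewrite mulrACA.
rewrite big_distrr; apply: eq_bigr => x _ /=.
rewrite (bigD1 x) //= [X in _ + X]big1 ?addr0 => [|y nyx].
  by rewrite -mulr_sumr sum_chi_trace subrr eqxx mul1r mulrC normCK.
by rewrite -mulr_sumr sum_chi_trace subr_eq0 eq_sym (negPf nyx) mul0r mulr0.
Qed.

(** Fourier inversion of [g] at [x - y] separates the variables into three transforms.
    Cauchy-Schwarz and Plancherel for [r] and [s] then produce exactly the powers of [q] that
    inversion cost. *)
Lemma mixing m p (g r s : 'M[F]_(m, p) -> algC) (M : algC) :
  (forall z, `|fourier g z| ^+ 2 <= M) ->
  `|\sum_x \sum_y r x * s y * g (x - y)| ^+ 2 <=
    M * (\sum_x `|r x| ^+ 2) * (\sum_x `|s x| ^+ 2).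
Proof.
move=> hM.
have q0 : 0 < (q%:R ^+ (m * p) : algC) by rewrite exprn_gt0 // ltr0n; apply/card_gt0P; exists 0.
pose r' z := \sum_x r x * (chi (\tr (z *m x)))^*.
have key : q%:R ^+ (m * p) * (\sum_x \sum_y r x * s y * g (x - y)) =
    \sum_z (fourier g z * r' z) * fourier s z.
  transitivity (\sum_x \sum_y \sum_t \sum_(z : 'M_(p, m))
      r x * s y * g t * chi (\tr (z *m (t - (x - y))))).
    rewrite big_distrr; apply: eq_bigr => x _; rewrite big_distrr; apply: eq_bigr => y _ /=.
    rewrite (bigD1 (x - y)) //= [X in _ = _ + X]big1 ?addr0 => [|t nt].
      by rewrite -mulr_sumr sum_chi_trace subrr eqxx mul1r mulrC.
    by rewrite -mulr_sumr sum_chi_trace subr_eq0 (negPf nt) mul0r mulr0.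
  transitivity (\sum_(z : 'M_(p, m)) \sum_x \sum_y \sum_t
      r x * s y * g t * chi (\tr (z *m (t - (x - y))))).
    rewrite [RHS]exchange_big; apply: eq_bigr => x _.
    rewrite [RHS]exchange_big; apply: eq_bigr => y _.
    by rewrite [RHS]exchange_big.
  apply: eq_bigr => z _; rewrite [fourier g z * _]mulrC -mulrA [fourier g z * _]mulrC.
  rewrite /r' mulr_suml; apply: eq_bigr => x _.
  rewrite /fourier mulr_suml mulr_sumr; apply: eq_bigr => y _; rewrite mulrA mulr_sumr.
  apply: eq_bigr => t _; rewrite opprB addrC -addrA mulmxDr mxtraceD chiD.
  rewrite mulmxDr mxtraceD chiD chi_traceN; ring.
have hr' : \sum_z `|r' z| ^+ 2 = q%:R ^+ (m * p) * \sum_x `|r x| ^+ 2.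
  transitivity (\sum_z `|fourier (fun x => (r x)^*) z| ^+ 2); last first.
    by rewrite plancherel; congr (_ * _); apply: eq_bigr => x _; rewrite norm_conjC.
  apply: eq_bigr => z _; rewrite -norm_conjC rmorph_sum /=; congr (`|_| ^+ 2).
  by apply: eq_bigr => x _; rewrite rmorphM /= conjCK.
rewrite -(@ler_pM2l _ ((q%:R ^+ (m * p)) ^+ 2)) ; last exact: exprn_gt0.
rewrite -{1}[q%:R ^+ (m * p)]gtr0_norm // -exprMn -normrM key.
apply: le_trans (cauchy_schwarz _ _) _; rewrite plancherel.
have -> : (q%:R ^+ (m * p)) ^+ 2 * (M * (\sum_x `|r x| ^+ 2) * (\sum_x `|s x| ^+ 2))
  = (M * \sum_z `|r' z| ^+ 2) * (q%:R ^+ (m * p) * \sum_x `|s x| ^+ 2) by rewrite hr'; ring.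
apply: ler_wpM2r.
  by rewrite mulr_ge0 ?(ltW q0) ?sumr_ge0 // => x _; rewrite exprn_ge0.
rewrite mulr_sumr; apply: ler_sum => z _; rewrite normrM exprMn.
by apply: ler_wpM2r; rewrite ?exprn_ge0.
Qed.

End Fourier.

(** * Counting in the special linear group *)

(** Conjugation by a unipotent block matrix turns a block triangular matrix with diagonal [1 + w u],
    [1] into one with diagonal [1], [1 + u w]. *)
Lemma det_1D_mul (R : comPzRingType) n (w : 'cV[R]_n) (u : 'rV[R]_n) :
  \det (1%:M + w *m u) = 1 + (u *m w) 0 0.
Proof.
have e : block_mx 1%:M 0 u 1%:M *m block_mx (1%:M + w *m u) w 0 1%:M
    *m block_mx 1%:M 0 (- u) 1%:M = block_mx 1%:M w 0 (1%:M + u *m w).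
  rewrite !mulmx_block ?mulmx1 ?mul1mx ?mulmx0 ?mul0mx ?addr0 ?add0r ?mulmxN.
  congr block_mx.
  - by rewrite addrK.
  - by rewrite mulmxDr mulmxDl mulmx1 mul1mx mulmxA [X in X - _]addrC subrr.
  - by rewrite addrC.
have /(congr1 determinant) := e; rewrite !det_mulmx !det_lblock !det_ublock !det1.
by rewrite !mul1r !mulr1 det_mx11 !mxE eqxx.
Qed.

Lemma row_col_mul_eq (F : fieldType) n (u : 'rV[F]_n) (t : F) :
  u != 0 -> exists w : 'cV_n, (u *m w) 0 0 = t.
Proof.
move=> nu; have [j nj] : exists j, u 0 j != 0.
  apply/existsP; apply: contraNT nu; rewrite negb_exists => /forallP h.
  by apply/eqP/rowP => j; rewrite mxE; apply/eqP/negPn/h.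
exists (delta_mx j 0 *m (t / u 0 j)%:M).
rewrite mulmxA mxE big_ord1 -colE !mxE eqxx mulr1n mulrC divfK //.
Qed.

(** For [u] in the left kernel of [z], every [1 + w u] fixes [z], and its determinant [1 + u w] is
    arbitrary. *)
Lemma singular_stabilizer_det (F : fieldType) n (z : 'M[F]_n) (t : F) :
  \det z = 0 -> exists k, \det k = t /\ k *m z = z.
Proof.
move/eqP/det0P => [u nu uz]; have [w hw] := row_col_mul_eq (t - 1) nu.
exists (1%:M + w *m u); rewrite det_1D_mul hw; split; first by rewrite addrC subrK.
by rewrite mulmxDl mul1mx -mulmxA uz mulmx0 addr0.
Qed.

(** With at least two rows, the matrix all of whose rows are [v] is singular; the previous lemma
    applies to its transpose. *)
Lemma row_stabilizer_det (F : fieldType) n (v : 'rV[F]_n) (t : F) :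
  (1 < n)%N -> exists k, \det k = t /\ v *m k = v.
Proof.
case: n v => [|[|n]] // v _.
have dz : \det (\matrix_(i < n.+2, j < n.+2) v 0 j) = 0.
  by apply: (@determinant_alternate _ _ _ 0 1) => // j; rewrite !mxE.
have [k [dk hk]] := singular_stabilizer_det t (etrans (det_tr _) dz).
exists k^T; rewrite det_tr; split=> //.
apply: trmx_inj; rewrite trmx_mul trmxK; apply/colP => i.
move/matrixP/(_ i 0): hk; rewrite !mxE => <-.
by apply: eq_bigr => j _; rewrite !mxE.
Qed.

(** An invertible matrix carrying [u] to [v] exists by completion of bases; its determinant is
    corrected by an element of the stabilizer of [v]. *)
Lemma SLn_transitive (F : fieldType) n (u v : 'rV[F]_n) :
  (1 < n)%N -> u != 0 -> v != 0 -> exists g, \det g = 1 /\ u *m g = v.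
Proof.
move=> n1 nu nv; have rf : row_free u by rewrite /row_free rank_rV nu.
have e : u *m (pinvmx u *m v) = v by rewrite mulmxA mulmxVp // mul1mx.
have [|g ug eg] := @complete_unitmx F 1 n u (pinvmx u *m v).
  by rewrite e !rank_rV nu nv.
have dg : \det g != 0 by rewrite -unitfE -unitmxE.
have [k [dk hk]] := row_stabilizer_det v (\det g)^-1 n1.
exists (g *m k); rewrite det_mulmx dk mulfV //; split=> //.
by rewrite mulmxA -eg e.
Qed.

Lemma exists_det (F : fieldType) n (t : F) : (0 < n)%N -> exists k : 'M[F]_n, \det k = t.
Proof.
case: n => // n _; exists (1%:M + (delta_mx 0 0 : 'cV_n.+1) *m ((t - 1) *: (delta_mx 0 0 : 'rV_n.+1))).
by rewrite det_1D_mul -scalemxAl mul_delta_mx !mxE eqxx mulr1 addrC subrK.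
Qed.

Section Counting.
Variables (F : finFieldType) (n : nat).
Local Notation q := (#|F|).
Local Notation SL := (SLn F n).

Lemma inSLn (x : 'M[F]_n) : (x \in SL) = (\det x == 1).
Proof. by rewrite inE. Qed.

Lemma mulmx_injl (k : 'M[F]_n) : \det k != 0 -> injective (mulmx k : 'M[F]_n -> 'M_n).
Proof.
by rewrite -unitfE -unitmxE => uk x y /(congr1 (mulmx (invmx k))); rewrite !mulKmx.
Qed.

Lemma mulmx_injr (k : 'M[F]_n) : \det k != 0 -> injective ((mulmx^~ k) : 'M[F]_n -> 'M_n).
Proof.
by rewrite -unitfE -unitmxE => uk x y /(congr1 (mulmx^~ (invmx k))); rewrite !mulmxK.
Qed.

Lemma SLn_gt0 : (0 < #|SL|)%N.
Proof. by apply/card_gt0P; exists 1%:M; rewrite inSLn det1. Qed.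

Lemma card_det_eq (t : F) : (0 < n)%N -> t != 0 -> #|[pred x : 'M[F]_n | \det x == t]| = #|SL|.
Proof.
move=> n0 nt; have [k dk] := exists_det t n0.
have nk : \det k != 0 by rewrite dk.
rewrite -[RHS](card_imset _ (mulmx_injl nk)); apply: eq_card => x.
rewrite [LHS]inE; apply/eqP/imsetP => [dx|[y]]; last by rewrite inSLn => /eqP dy ->; rewrite det_mulmx dk dy mulr1.
exists (invmx k *m x); last by rewrite mulKVmx // unitmxE unitfE.
by rewrite inSLn det_mulmx det_inv dk dx mulVf.
Qed.

Lemma card_nonzero_rows : #|[pred w : 'rV[F]_n | w != 0]| = (q ^ n).-1.
Proof.
have := cardC (pred1 (0 : 'rV[F]_n)); rewrite card1 card_mx mul1n => <-.
by rewrite add1n; apply: eq_card.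
Qed.

(** By transitivity the fibres of [b |-> v b] over the [q ^ n - 1] nonzero rows have equal size, and
    the fibre over 0 is empty. *)
Lemma card_row_image (v w : 'rV[F]_n) : (1 < n)%N -> v != 0 ->
  ((q ^ n).-1 * #|[set b in SL | v *m b == w]| <= #|SL|)%N.
Proof.
move=> n1 nv; case: (eqVneq w 0) => [->|nw].
  rewrite [X in (_ * X)%N](_ : _ = 0%N) ?muln0 //; apply/eqP; rewrite cards_eq0.
  apply/eqP/setP => b; rewrite !inE; apply/negP => /andP[/eqP db /eqP vb].
  have : b \in unitmx by rewrite unitmxE db unitr1.
  by move=> ub; move: (mulmxK ub v); rewrite vb mul0mx => /esym/eqP; rewrite (negPf nv).
have eqN (w' : 'rV_n) : w' != 0 ->
    #|[set b in SL | v *m b == w']| = #|[set b in SL | v *m b == w]|.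
  move=> nw'; have [g [dg wg]] := SLn_transitive n1 nw nw'.
  have ng : \det g != 0 by rewrite dg oner_eq0.
  rewrite -[RHS](card_imset _ (mulmx_injr ng)); apply: eq_card => b.
  apply/idP/imsetP => [|[y]]; rewrite !inE.
    move=> /andP[/eqP db /eqP vb]; exists (b *m invmx g); last first.
      by rewrite mulmxKV // unitmxE unitfE.
    rewrite !inE det_mulmx det_inv dg db invr1 mulr1 eqxx /= mulmxA vb -wg.
    by rewrite mulmxK // unitmxE unitfE.
  by move=> /andP[/eqP dy /eqP vy] ->; rewrite det_mulmx dy dg mulr1 mulmxA vy wg !eqxx.
rewrite -card_nonzero_rows.
rewrite -sum_nat_const -[X in (_ <= X)%N]sum1_card.
rewrite (partition_big (fun b => v *m b) predT) //=.
rewrite [X in (_ <= X)%N](bigID (fun w' : 'rV_n => w' != 0)) /=.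
apply: leq_trans (leq_addr _ _); apply: eq_leq; apply: eq_bigr => w' nw'.
by rewrite -(eqN w' nw') -sum1_card; apply: eq_bigl => b; rewrite !inE.
Qed.

(** Double counting of pairs [(b, v)] with [v != 0] and [v b = - v c]: a singular [b + c] has at
    least [q - 1] such [v], the nonzero multiples of one kernel vector, and [card_row_image] bounds
    the [b] for each [v]. *)
Lemma card_singular_translate (c : 'M[F]_n) : (1 < n)%N ->
  (q.-1 * #|[set b in SL | (\det (b + c) == 0)%R]| <= #|SL|)%N.
Proof.
move=> n1; have qn : (0 < (q ^ n).-1)%N.
  by rewrite -subn1 subn_gt0 -(exp1n n) ltn_exp2r ?finNzRing_gt1 // ltnW.
rewrite -(leq_pmul2l qn).
have h1 : (q.-1 * #|[set b in SL | (\det (b + c) == 0)%R]| <=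
    \sum_(v : 'rV[F]_n | v != 0%R) #|[set b in SL | (v *m b == - (v *m c))%R]|)%N.
  rewrite mulnC -sum_nat_const.
  rewrite [X in (_ <= X)%N](eq_bigr (fun v : 'rV[F]_n =>
      \sum_(b in SL) (v *m b == - (v *m c))%R : nat))%N; last first.
    by move=> v _; rewrite -sum1_card big_mkcond /= [RHS]big_mkcond /=;
       apply: eq_bigr => b _; rewrite !inE; case: (\det b == 1) => //=; case: eqP.
  rewrite exchange_big /= [X in (_ <= X)%N](bigID (fun b : 'M[F]_n => (\det (b + c) == 0)%R)) /=.
  apply: leq_trans (leq_addr _ _).
  rewrite (eq_bigl (fun b => (b \in SL) && (\det (b + c) == 0)%R)); last by move=> b; rewrite inE.
  apply: leq_sum => b /andP[_ /det0P[u nu hu]].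
  have inj : injective (fun s : F => s *: u).
    move=> s1 s2 /eqP; rewrite -subr_eq0 -scalerBl scaler_eq0 (negPf nu) orbF.
    by rewrite subr_eq0 => /eqP.
  have -> : q.-1 = #|[pred s : F | s != 0]|.
    have := cardC (pred1 (0 : F)); rewrite card1 => <-.
    by rewrite add1n; apply: eq_card.
  rewrite -(card_image inj) -sum1_card big_mkcond [X in (_ <= X)%N]big_mkcond /=.
  apply: leq_sum => v _; case: ifP => // /imageP[s ns ->].
  rewrite scaler_eq0 (negPf ns) (negPf nu) /=.
  move/eqP: hu; rewrite mulmxDr addr_eq0 => /eqP hu.
  by rewrite -!scalemxAl hu -scalerN eqxx.
apply: leq_trans (leq_mul (leqnn _) h1) _; rewrite big_distrr /=.
apply: leq_trans (_ : \sum_(v : 'rV[F]_n | v != 0%R) #|SL| <= _)%N.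
  by apply: leq_sum => v nv; apply: card_row_image.
by rewrite sum_nat_const -card_nonzero_rows.
Qed.
End Counting.

(** * Mixing for functions of the determinant *)

Lemma sum_by_value (R : nmodType) (I J : finType) (p : I -> J) (g : J -> R) :
  \sum_i g (p i) = \sum_j g j *+ #|[pred i | p i == j]|.
Proof.
rewrite (partition_big p predT) //=; apply: eq_bigr => j _.
rewrite -sumr_const; apply: eq_big => [i|i /eqP -> //]; by rewrite inE.
Qed.

Section DetFunctions.
Variables (F : finFieldType) (chi : F -> algC).
Hypothesis chi0 : chi 0 = 1.
Hypothesis chiD : forall x y, chi (x + y) = chi x * chi y.
Hypothesis chiN : forall x, chi (- x) = (chi x)^*.
Hypothesis sum_chi : \sum_x chi x = 0.
Local Notation q := (#|F|).
Variables (n : nat) (gamma : F -> algC).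
Hypothesis n0 : (0 < n)%N.
Hypothesis gamma0 : gamma 0 = 0.
Hypothesis sum_gamma : \sum_t gamma t = 0.

Local Notation g := (fun x : 'M[F]_n => gamma (\det x)).

Lemma sum_scaled (s : F) : s != 0 -> \sum_(t | t != 0) gamma (t * s) = 0.
Proof.
move=> ns; have := sum_gamma; rewrite (bigD1 0) //= gamma0 add0r.
rewrite (reindex_inj (mulIf ns)) /= => h; rewrite -[RHS]h; apply: eq_bigl => t.
by rewrite mulf_eq0 (negPf ns) orbF.
Qed.

(* A singular [z] is fixed by matrices of every determinant, so its coefficient
   does not distinguish the nonzero values of [\det]. *)
Lemma fourier_det_singular (z : 'M[F]_n) : \det z = 0 -> fourier chi g z = 0.
Proof.
move=> dz.
have inv t : t != 0 ->
    \sum_x gamma (t * \det x) * chi (\tr (z *m x)) = fourier chi g z.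
  move=> nt; have [k [dk kz]] := singular_stabilizer_det t dz.
  have nk : \det k != 0 by rewrite dk.
  rewrite /fourier [RHS](reindex_inj (mulmx_injr nk)) /=; apply: eq_bigr => x _.
  by rewrite det_mulmx dk [\det x * t]mulrC mulmxA [in RHS]mxtrace_mulC mulmxA kz.
have : \sum_(t | t != 0) \sum_x gamma (t * \det x) * chi (\tr (z *m x)) = 0.
  rewrite exchange_big big1 //= => x _; rewrite -mulr_suml.
  have [->|nx] := eqVneq (\det x) 0; last by rewrite sum_scaled ?mul0r.
  by rewrite big1 ?mul0r // => t _; rewrite mulr0.
rewrite (eq_bigr (fun=> fourier chi g z)) => [/eqP|t nt]; last exact: inv.
rewrite sumr_const mulrn_eq0 => /orP[|/eqP //].
rewrite eqn0Ngt => /negP[]; apply/card_gt0P; exists 1; exact: oner_neq0.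
Qed.

Lemma sum_norm_det : \sum_(x : 'M[F]_n) `|gamma (\det x)| ^+ 2 =
  #|SLn F n|%:R * \sum_t `|gamma t| ^+ 2.
Proof.
rewrite (sum_by_value (fun x : 'M[F]_n => \det x) (fun t => `|gamma t| ^+ 2)).
rewrite mulr_sumr; apply: eq_bigr => t _.
have [->|nt] := eqVneq t 0; first by rewrite gamma0 normr0 expr0n mul0rn mulr0.
by rewrite card_det_eq // mulr_natl.
Qed.

(** For invertible [z] the orbit has [#|SLn F n|] distinct points, which is also the size of each
    fibre of [\det] over a nonzero value; the two factors cancel. *)
Lemma fourier_det_le (z : 'M[F]_n) :
  `|fourier chi g z| ^+ 2 <= q%:R ^+ (n * n) * \sum_t `|gamma t| ^+ 2.
Proof.
have [dz|nz] := eqVneq (\det z) 0.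
  rewrite fourier_det_singular // normr0 expr0n mulr_ge0 ?exprn_ge0 ?ler0n //.
  by apply: sumr_ge0 => t _; rewrite exprn_ge0.
have S0 : 0 < (#|SLn F n|%:R : algC) by rewrite ltr0n SLn_gt0.
rewrite -(ler_pM2l S0) [X in _ <= X]mulrCA -sum_norm_det -(plancherel chi0 chiD chiN sum_chi).
rewrite mulr_natl -sumr_const.
rewrite (eq_bigr (fun k => `|fourier chi g (z *m k)| ^+ 2)) => [|k]; last first.
  rewrite inSLn => /eqP dk; congr (`|_| ^+ 2); rewrite /fourier.
  have nk : \det k != 0 by rewrite dk oner_eq0.
  rewrite (reindex_inj (mulmx_injl nk)) /=; apply: eq_bigr => x _.
  by rewrite det_mulmx dk mul1r mulmxA.
rewrite -(big_imset (fun y => `|fourier chi g y| ^+ 2)) /=; last first.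
  by move=> k l _ _; apply: mulmx_injl.
rewrite [X in _ <= X](bigID (mem [set z *m k | k in SLn F n])) /= lerDl.
by apply: sumr_ge0 => y _; rewrite exprn_ge0.
Qed.

End DetFunctions.

Lemma det_mixing (F : finFieldType) n (gamma : F -> algC) (r s : 'M[F]_n -> algC) :
  (0 < n)%N -> gamma 0 = 0 -> \sum_t gamma t = 0 ->
  `|\sum_x \sum_y r x * s y * gamma (\det (x - y))| ^+ 2 <=
    #|F|%:R ^+ (n * n) * (\sum_t `|gamma t| ^+ 2) *
    (\sum_x `|r x| ^+ 2) * (\sum_x `|s x| ^+ 2).
Proof.
move=> n0 g0 sg; have [chi [c0 cD cN sc]] := nontrivial_additive_character F.
apply: (mixing c0 cD cN sc (g := fun x => gamma (\det x))).
exact: fourier_det_le.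
Qed.

(** [det_mixing] is applied to [gamma] minus its mean over the nonzero scalars, taken to be 0 at 0.
    Multiplying by [#|F| - 1] clears the denominator of the mean, and the variance is bounded by the
    second moment. *)
Lemma det_mixing_nat (F : finFieldType) n (gamma : F -> nat) (r s : 'M[F]_n -> nat) (X Y : nat) :
  (0 < n)%N -> gamma 0 = 0%N ->
  X = (\sum_x \sum_y r x * s y * gamma (\det (x - y))%R)%N ->
  Y = (\sum_x \sum_y r x * s y * (\det (x - y) != 0)%R)%N ->
  (#|F|.-1%:Z * X%:Z - (\sum_t gamma t)%N%:Z * Y%:Z) ^+ 2 <=
  (#|F|.-1 ^ 2 * #|F| ^ (n * n) * (\sum_t gamma t ^ 2) *
    (\sum_x r x ^ 2) * (\sum_x s x ^ 2))%N%:Z.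
Proof.
move=> n0 g0 eX eY; rewrite -(ler_int algC).
have qp : (0 < #|F|.-1)%N by rewrite -subn1 subn_gt0 finNzRing_gt1.
have card_units : #|[pred t : F | t != 0]| = #|F|.-1.
  have := cardC (pred1 (0 : F)); rewrite card1 => <-.
  by rewrite add1n; apply: eq_card.
set k := #|F|.-1 in qp card_units *; set S := (\sum_t gamma t)%N.
have k0 : (k%:R : algC) != 0 by rewrite pnatr_eq0 -lt0n.
pose mu : algC := S%:R / k%:R.
pose d t : algC := (gamma t)%:R - mu * (t != 0)%:R.
have mur : mu \is Num.real by rewrite rpredM ?rpredV ?realn.
have d0 : d 0 = 0 by rewrite /d g0 eqxx mulr0 subr0.
have sum_u : \sum_(t : F) ((t != 0)%:R : algC) = k%:R.
  rewrite -card_units -sum1_card natr_sum [RHS]big_mkcond /=.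
  by apply: eq_bigr => t _; rewrite inE; case: (t != 0).
have sd : \sum_t d t = 0.
  by rewrite sumrB -mulr_sumr sum_u divfK // -natr_sum subrr.
have muS : mu * k%:R = S%:R by rewrite divfK.
have sd2 : \sum_t `|d t| ^+ 2 <= \sum_t (gamma t)%:R ^+ 2.
  have -> : \sum_t `|d t| ^+ 2 = \sum_t (gamma t)%:R ^+ 2 - mu ^+ 2 * k%:R.
    have -> : mu ^+ 2 * k%:R = mu * \sum_t (gamma t)%:R *+ 2 - mu ^+ 2 * \sum_(t : F) (t != 0)%:R.
      by rewrite sum_u sumrMnl -natr_sum -muS; ring.
    rewrite !mulr_sumr -!sumrB; apply: eq_bigr => t _.
    have dr : d t \is Num.real by apply: rpredB; rewrite ?realn //; apply: rpredM; rewrite ?realn.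
    rewrite real_normK // /d; case: eqVneq => [->|_]; rewrite ?g0 /=; ring.
  by rewrite gerBl; apply: mulr_ge0; rewrite ?ler0n // real_exprn_even_ge0.
have := det_mixing (fun x => (r x)%:R) (fun x => (s x)%:R) n0 d0 sd.
have -> : \sum_x \sum_y (r x)%:R * (s y)%:R * d (\det (x - y)) = X%:R - mu * Y%:R.
  rewrite eX eY !natr_sum mulr_sumr -sumrB; apply: eq_bigr => x _.
  rewrite !natr_sum mulr_sumr -sumrB; apply: eq_bigr => y _.
  by rewrite /d !natrM; ring.
move=> h.
have h2 : (X%:R - mu * Y%:R) ^+ 2 <= #|F|%:R ^+ (n * n) * (\sum_t (gamma t)%:R ^+ 2) *
    (\sum_x (r x)%:R ^+ 2) * (\sum_x (s x)%:R ^+ 2) :> algC.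
  move: h; rewrite real_normK; last first.
    by apply: rpredB; rewrite ?realn //; apply: rpredM; rewrite ?realn.
  move=> h; apply: le_trans h _.
  have nn (T : finType) (a : T -> nat) : \sum_x `|(a x)%:R| ^+ 2 = \sum_x (a x)%:R ^+ 2 :> algC.
    by apply: eq_bigr => x _; rewrite normr_nat.
  rewrite !nn; do 2 (apply: ler_wpM2r; first by apply: sumr_ge0 => x _; rewrite exprn_ge0 ?ler0n).
  by apply: ler_wpM2l; rewrite ?exprn_ge0 ?ler0n.
have -> : (((k%:Z * X%:Z - S%:Z * Y%:Z) ^+ 2)%:~R : algC) = k%:R ^+ 2 * (X%:R - mu * Y%:R) ^+ 2.
  by rewrite -exprMn mulrBr mulrA [_ * mu]mulrC muS rmorphXn rmorphB !rmorphM.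
have -> : (((k ^ 2 * #|F| ^ (n * n) * (\sum_t gamma t ^ 2) * (\sum_x r x ^ 2) *
   (\sum_x s x ^ 2))%N%:Z)%:~R : algC) = k%:R ^+ 2 * (#|F|%:R ^+ (n * n) * (\sum_t (gamma t)%:R ^+ 2) *
    (\sum_x (r x)%:R ^+ 2) * (\sum_x (s x)%:R ^+ 2)).
  rewrite -pmulrn !natrM !natrX !natr_sum !mulrA.
  by congr (_ * _ * _ * _); apply: eq_bigr => x _; rewrite natrX.
by apply: ler_wpM2l; rewrite // exprn_ge0 ?ler0n.
Qed.

(** * Averaging over the transvections of one row *)

Lemma cauchy_schwarz_cond (R : numFieldType) (I : finType) (P : pred I) (x y : I -> R) :
  `|\sum_(i | P i) x i * y i| ^+ 2 <=
    (\sum_(i | P i) `|x i| ^+ 2) * (\sum_(i | P i) `|y i| ^+ 2).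
Proof.
pose x' i := if P i then x i else 0; pose y' i := if P i then y i else 0.
have e (a c : I -> R) : (forall i, c i = if P i then a i else 0) ->
    \sum_(i | P i) a i = \sum_i c i.
  by move=> h; rewrite big_mkcond; apply: eq_bigr => i _; rewrite h.
rewrite (e _ (fun i => x' i * y' i)) => [|i]; last by rewrite /x' /y'; case: ifP; rewrite ?mulr0.
rewrite (e _ (fun i => `|x' i| ^+ 2)) => [|i]; last first.
  by rewrite /x'; case: ifP; rewrite ?normr0 ?expr0n.
rewrite (e _ (fun i => `|y' i| ^+ 2)) => [|i]; last first.
  by rewrite /y'; case: ifP; rewrite ?normr0 ?expr0n.
exact: cauchy_schwarz.
Qed.

(** Up to inversion, convolution of a function on the group with a function on the whole matrix
    space; accordingly [h] in [energy] runs over all matrices, singular ones included. *)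
Definition inner (F : finFieldType) n (phi f : 'M[F]_n -> algC) (h : 'M[F]_n) : algC :=
  \sum_(x in SLn F n) phi x * f (h *m x).

Definition energy (F : finFieldType) n (phi f : 'M[F]_n -> algC) : algC :=
  \sum_h `|inner phi f h| ^+ 2.

Definition sqnorm (F : finFieldType) n (phi : 'M[F]_n -> algC) : algC :=
  \sum_(x in SLn F n) `|phi x| ^+ 2.

Section RowTransvections.
Variables (F : finFieldType) (m : nat) (i : 'I_m.+1).
Local Notation n := m.+1.
Local Notation q := (#|F|).
Local Notation SL := (SLn F n).
Let e : 'cV[F]_n := delta_mx i 0.
Let R : 'M[F]_(m, n) := row' i 1%:M.

(** Left multiplication by it adds to row [i] the combination of the other rows with coefficients
    [w]. *)
Definition row_transv (w : 'rV[F]_m) : 'M[F]_n := 1%:M + delta_mx i 0 *m (w *m row' i 1%:M).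
Local Notation u := row_transv.

Lemma row_incl_col0 : R *m e = 0.
Proof.
apply/matrixP => a b; rewrite /R row'Esub mul_rowsub_mx mul1mx !mxE.
by rewrite eq_sym (negPf (neq_lift _ _)).
Qed.

Lemma row_incl_mul_tr : R *m R^T = 1%:M.
Proof.
apply/matrixP => a b; rewrite {1}/R row'Esub mul_rowsub_mx mul1mx !mxE.
by rewrite (inj_eq (@lift_inj _ i)) eq_sym.
Qed.

Lemma transvD w v : u w *m u v = u (w + v).
Proof.
rewrite /u -/e -/R mulmxDl mul1mx mulmxDr mulmx1 !mulmxDl !mulmxDr.
rewrite -[e *m _ *m (e *m _)]mulmxA [w *m R *m _]mulmxA -[w *m R *m e]mulmxA row_incl_col0.
by rewrite mulmx0 mul0mx mulmx0 addr0 -addrA [X in _ + X]addrC.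
Qed.

Lemma transv0 : u 0 = 1%:M.
Proof. by rewrite /u mul0mx mulmx0 addr0. Qed.

Lemma det_transv w : \det (u w) = 1.
Proof. by rewrite det_1D_mul -mulmxA -/e -/R row_incl_col0 mulmx0 mxE addr0. Qed.

Lemma transv_SL w x : (u w *m x \in SL) = (x \in SL).
Proof. by rewrite !inSLn det_mulmx det_transv mul1r. Qed.

Lemma transv_neq0 w : \det (u w) != 0.
Proof. by rewrite det_transv oner_eq0. Qed.

(** The matrix [l] is [M] on the coordinates other than [i] and the identity on coordinate [i]. It
    normalises the transvections of row [i] and acts on their parameters through [M]. *)
Lemma transv_conj (M : 'M[F]_m) : \det M = 1 ->
  exists l : 'M[F]_n, \det l = 1 /\ forall w, u w *m l = l *m u (w *m M).
Proof.
move=> dM; pose l := R^T *m M *m R + e *m e^T; exists l.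
have ee : e^T *m e = 1%:M.
  by rewrite /e trmx_delta mul_delta_mx; apply/matrixP=> a b; rewrite !ord1 !mxE.
have Rl : R *m l = M *m R.
  by rewrite mulmxDr !mulmxA row_incl_mul_tr mul1mx row_incl_col0 mul0mx addr0.
have le : l *m e = e.
  by rewrite mulmxDl -mulmxA row_incl_col0 mulmx0 add0r -mulmxA ee mulmx1.
split; last first.
  move=> w; rewrite /u -/e -/R mulmxDl mul1mx mulmxDr mulmx1.
  by rewrite -!mulmxA Rl [l *m (e *m _)]mulmxA le.
have hl a b : l a b = (R^T *m M *m R) a b + (a == i)%:R * (b == i)%:R.
  by rewrite /l mxE; congr (_ + _); rewrite mxE big_ord1 !mxE !andbT.
have hR a b : R a b = (lift i a == b)%:R by rewrite !mxE.
have hRt a c (X : 'M_(m, c)) b : (R^T *m X) (lift i a) b = X a b.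
  rewrite mxE (bigD1 a) //= big1 => [|k ka]; first by rewrite mxE hR eqxx mul1r addr0.
  by rewrite mxE hR (inj_eq (@lift_inj _ i)) (negPf ka) mul0r.
have hRt0 c (X : 'M_(m, c)) b : (R^T *m X) i b = 0.
  by rewrite mxE big1 // => k _; rewrite mxE hR eq_sym (negPf (neq_lift _ _)) mul0r.
have hXR a (X : 'M_(a, m)) b c : (X *m R) b (lift i c) = X b c.
  rewrite mxE (bigD1 c) //= big1 => [|k ka]; first by rewrite hR eqxx mulr1 addr0.
  by rewrite hR (inj_eq (@lift_inj _ i)) (negPf ka) mulr0.
rewrite (expand_det_row l i) (bigD1 i) //= big1 => [|j ji].
  rewrite hl -mulmxA hRt0 eqxx add0r !mul1r addr0 /cofactor -signr_odd oddD addbb mul1r.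
  rewrite -[RHS]dM; congr (\det _); apply/matrixP => a b; rewrite [LHS]mxE [LHS]mxE.
  by rewrite hl -mulmxA hRt hXR eq_sym (negPf (neq_lift _ _)) mul0r addr0.
by rewrite hl -mulmxA hRt0 (negPf ji) mulr0 addr0 mul0r.
Qed.

Lemma reindex_SL (R' : nmodType) (k : 'M[F]_n) (g : 'M[F]_n -> R') : \det k = 1 ->
  \sum_(x in SL) g (k *m x) = \sum_(x in SL) g x.
Proof.
move=> dk; have nk : \det k != 0 by rewrite dk oner_eq0.
rewrite [RHS](reindex_inj (mulmx_injl nk)) /=; apply: eq_bigl => x.
by rewrite !inSLn det_mulmx dk mul1r.
Qed.

Definition row_sum (phi : 'M[F]_n -> algC) (x : 'M[F]_n) : algC := \sum_w phi (u w *m x).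

Section Bound.
Variable chi : F -> algC.
Hypothesis chi0 : chi 0 = 1.
Hypothesis chiD : forall x y, chi (x + y) = chi x * chi y.
Hypothesis chiN : forall x, chi (- x) = (chi x)^*.
Hypothesis sum_chi : \sum_x chi x = 0.
Variables phi f : 'M[F]_n -> algC.
Hypothesis m2 : (1 < m)%N.

(** Frequencies [y] are dual to the transvection group. [G] and [Fy] are transforms along
    [h *m u w]; [Psi] is, up to a scalar, the component of [phi] of frequency [y] under left
    transvections; [Q] and [Phi] are the masses of [Fy] and [Psi] at [y]. *)
Let G h y := fourier chi (fun w : 'rV[F]_m => inner phi f (h *m u w)) y.
Let Fy h x y := fourier chi (fun w : 'rV[F]_m => f (h *m u w *m x)) y.
Let Psi x y := \sum_(v : 'rV[F]_m) phi (u v *m x) * (chi (\tr (y *m v)))^*.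
Let Q y := \sum_h \sum_(x in SL) `|Fy h x y| ^+ 2.
Let Phi y := \sum_(x in SL) `|Psi x y| ^+ 2.
Let qm : algC := q%:R ^+ m.

Lemma chi_conj s : chi s * (chi s)^* = 1.
Proof. by rewrite -chiN -chiD subrr. Qed.

Lemma fourier_innerE h y : G h y = \sum_(x in SL) phi x * Fy h x y.
Proof.
rewrite /G /Fy /fourier /inner.
rewrite (eq_bigr (fun w => \sum_(x in SL) phi x * f (h *m u w *m x) * chi (\tr (y *m w)))) => [|w _].
  by rewrite exchange_big; apply: eq_bigr => x _; rewrite mulr_sumr; apply: eq_bigr => w _; rewrite mulrA.
by rewrite mulr_suml.
Qed.

Lemma Fy_transv h x y v : Fy h (u v *m x) y = (chi (\tr (y *m v)))^* * Fy h x y.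
Proof.
rewrite /Fy /fourier mulr_sumr [RHS](reindex_inj (addIr v)) /=; apply: eq_bigr => w _.
rewrite mulmxA -[h *m u w *m u v]mulmxA transvD [y *m (w + v)]mulmxDr mxtraceD chiD.
rewrite -[LHS]mulr1 -(chi_conj (\tr (y *m v))); ring.
Qed.

(** Substituting [u v *m x] for [x] leaves [G] unchanged and multiplies [Fy] by a phase only. Summed
    over the [q ^ m] choices of [v], the phases collect [phi] into [Psi]. *)
Lemma scaled_fourier_inner h y : qm * G h y = \sum_(x in SL) Fy h x y * Psi x y.
Proof.
have -> : qm * G h y = \sum_(v : 'rV[F]_m) G h y.
  by rewrite sumr_const card_mx mul1n -mulr_natl natrX.
rewrite (eq_bigr (fun v => \sum_(x in SL) phi (u v *m x) * Fy h (u v *m x) y)) => [|v _]; last first.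
  by rewrite fourier_innerE -(reindex_SL _ (det_transv v)).
rewrite exchange_big; apply: eq_bigr => x _; rewrite mulr_sumr; apply: eq_bigr => v _ /=.
by rewrite Fy_transv; ring.
Qed.

Lemma norm_fourier_inner h y : qm ^+ 2 * `|G h y| ^+ 2 <= (\sum_(x in SL) `|Fy h x y| ^+ 2) * Phi y.
Proof.
have -> : qm ^+ 2 * `|G h y| ^+ 2 = `|qm * G h y| ^+ 2.
  by rewrite normrM exprMn [`|qm|]ger0_norm // exprn_ge0 // ler0n.
by rewrite scaled_fourier_inner; apply: cauchy_schwarz_cond.
Qed.

Lemma sum_sqr_Psi : \sum_y Phi y = qm ^+ 2 * sqnorm phi.
Proof.
rewrite /Phi exchange_big /=.
have h x : \sum_y `|Psi x y| ^+ 2 = qm * \sum_(v : 'rV_m) `|phi (u v *m x)| ^+ 2.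
  transitivity (\sum_y `|fourier chi (fun v : 'rV_m => (phi (u v *m x))^*) y| ^+ 2).
    apply: eq_bigr => y _; rewrite -norm_conjC /Psi rmorph_sum /=; congr (`|_| ^+ 2).
    by apply: eq_bigr => v _; rewrite rmorphM /= conjCK.
  rewrite (plancherel chi0 chiD chiN sum_chi) mul1n; congr (_ * _).
  by apply: eq_bigr => v _; rewrite norm_conjC.
rewrite (eq_bigr _ (fun x _ => h x)) -mulr_sumr exchange_big /= expr2 -mulrA; congr (_ * _).
rewrite (eq_bigr (fun=> sqnorm phi)) => [|v _].
  by rewrite sumr_const card_mx mul1n -mulr_natl natrX.
by rewrite (reindex_SL (fun x => `|phi x| ^+ 2) (det_transv v)).
Qed.

Lemma sum_sqr_Fy : \sum_y Q y = qm ^+ 2 * #|SL|%:R * \sum_x `|f x| ^+ 2.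
Proof.
rewrite /Q exchange_big /=.
rewrite (eq_bigr (fun h => \sum_(x in SL) qm * \sum_(w : 'rV_m) `|f (h *m u w *m x)| ^+ 2)) => [|h _].
  rewrite exchange_big /=.
  rewrite (eq_bigr (fun x => qm ^+ 2 * \sum_x `|f x| ^+ 2)) => [|x].
    by rewrite sumr_const -mulr_natr; ring.
  rewrite inSLn => /eqP dx; rewrite -mulr_sumr exchange_big expr2 -mulrA; congr (_ * _).
  rewrite (eq_bigr (fun=> \sum_x `|f x| ^+ 2)) => [|w _].
    by rewrite sumr_const card_mx mul1n -mulr_natl natrX.
  have nd : \det (u w *m x) != 0 by rewrite det_mulmx det_transv dx mul1r oner_eq0.
  rewrite [RHS](reindex_inj (mulmx_injr nd)) /=.
  by apply: eq_bigr => h _; rewrite mulmxA.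
rewrite exchange_big; apply: eq_bigr => x _.
by rewrite (plancherel chi0 chiD chiN sum_chi) mul1n.
Qed.

(** Conjugating by a normaliser element that carries one frequency to the other is absorbed by
    substitutions in [h] and [x]. Transitivity on nonzero frequencies is where [1 < m] enters. *)
Lemma sqr_Fy_const y y' : y != 0 -> y' != 0 -> Q y = Q y'.
Proof.
move=> ny ny'; have [g [dg hg]] : exists g, \det g = 1 /\ y^T *m g = y'^T.
  by apply: SLn_transitive; rewrite // trmx_eq0.
have gy : g^T *m y = y' by apply: trmx_inj; rewrite trmx_mul trmxK.
have ug : g^T \in unitmx by rewrite unitmxE det_tr dg unitr1.
have [l [dl hl]] : exists l : 'M[F]_n, \det l = 1 /\
    forall w, u w *m l = l *m u (w *m invmx g^T).
  by apply: transv_conj; rewrite det_inv det_tr dg invr1.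
have nl : \det l != 0 by rewrite dl oner_eq0.
have ul : l \in unitmx by rewrite unitmxE dl unitr1.
rewrite /Q [RHS](reindex_inj (mulmx_injr nl)) /=; apply: eq_bigr => h _.
rewrite -[LHS](reindex_SL _ dl); apply: eq_bigr => x _; congr (`|_| ^+ 2).
rewrite /Fy /fourier.
have inj : injective (fun w : 'rV[F]_m => w *m g^T) by move=> a b /(congr1 (mulmx^~ (invmx g^T))); rewrite !mulmxK.
rewrite (reindex_inj inj) /=; apply: eq_bigr => w _.
rewrite mulmxA -[h *m u _ *m l]mulmxA hl mulmxK // mulmxA; congr (_ * chi _).
by rewrite mxtrace_mulC -mulmxA gy mxtrace_mulC.
Qed.

Lemma fourier_inner0 h : G h 0 = inner (row_sum phi) f h.
Proof.
rewrite /G /fourier.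
rewrite (eq_bigr (fun w => \sum_(x in SL) phi (u (- w) *m x) * f (h *m x))) => [|w _].
  rewrite exchange_big; apply: eq_bigr => x _ /=; rewrite -mulr_suml; congr (_ * _).
  by rewrite [RHS](reindex_inj oppr_inj).
rewrite mul0mx mxtrace0 chi0 mulr1 /inner -(reindex_SL _ (det_transv (- w))).
by apply: eq_bigr => x _; rewrite -mulmxA [u w *m _]mulmxA transvD subrr transv0 mul1mx.
Qed.

(** Plancherel splits the energy by frequency, and frequency 0 is the energy of the row sum.
    Elsewhere the contribution is controlled by [Phi y * Q y], where the [q ^ m - 1] equal values of
    [Q] share one total. *)
Lemma energy_row_sum_char : (qm - 1) * (qm ^+ 2 * energy phi f) <=
  (qm - 1) * energy (row_sum phi) f + qm ^+ 2 * #|SL|%:R * sqnorm phi * \sum_x `|f x| ^+ 2.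
Proof.
have q0 : 0 < qm by rewrite exprn_gt0 // ltr0n; apply/card_gt0P; exists 0.
have q1 : 0 <= qm - 1.
  by rewrite subr_ge0 exprn_ege1 // ler1n; apply/card_gt0P; exists 0.
have eE : qm ^+ 2 * energy phi f = \sum_y \sum_h `|G h y| ^+ 2.
  rewrite exchange_big /=.
  rewrite (eq_bigr (fun h => qm * \sum_w `|inner phi f (h *m u w)| ^+ 2)) => [|h _]; last first.
    by rewrite (plancherel chi0 chiD chiN sum_chi) mul1n.
  rewrite -mulr_sumr exchange_big expr2 -mulrA; congr (_ * _).
  rewrite (eq_bigr (fun=> energy phi f)) => [|w _]; last first.
    by rewrite /energy [RHS](reindex_inj (mulmx_injr (transv_neq0 w))).
  by rewrite sumr_const card_mx mul1n -mulr_natl natrX.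
rewrite eE (bigD1 0) //= mulrDr.
have -> : \sum_h `|G h 0| ^+ 2 = energy (row_sum phi) f.
  by apply: eq_bigr => h _; rewrite fourier_inner0.
rewrite lerD2l -(ler_pM2l (exprn_gt0 2 q0)).
rewrite mulrCA mulr_sumr.
have Phi0 y : 0 <= Phi y by apply: sumr_ge0 => x _; rewrite exprn_ge0.
have Q0 y : 0 <= Q y.
  by apply: sumr_ge0 => h _; apply: sumr_ge0 => x _; rewrite exprn_ge0.
have hQ y : y != 0 -> (qm - 1) * Q y <= qm ^+ 2 * #|SL|%:R * \sum_x `|f x| ^+ 2.
  move=> ny; rewrite -sum_sqr_Fy [X in _ <= X](bigD1 0) //=.
  apply: le_trans (_ : \sum_(y' : 'cV[F]_m | y' != 0) Q y <= _).
    rewrite sumr_const -mulr_natl; apply: ler_wpM2r => //.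
    have := cardC (pred1 (0 : 'cV[F]_m)); rewrite card1 card_mx muln1 => /(congr1 (fun k => k%:R : algC)).
    rewrite natrD natrX -/qm => <-.
    by rewrite [1%:R + _]addrC addrK (eq_card (B := predC1 (0 : 'cV[F]_m))).
  rewrite (eq_bigr (fun y' => Q y')) => [|y' ny']; last exact: sqr_Fy_const.
  by rewrite lerDr.
apply: le_trans (_ : (qm - 1) * \sum_(y | y != 0) Phi y * Q y <= _).
  apply: ler_wpM2l => //; apply: ler_sum => y _.
  rewrite mulr_sumr [Phi y * _]mulrC mulr_suml; apply: ler_sum => h _; exact: norm_fourier_inner.
rewrite mulr_sumr.
apply: le_trans (_ : \sum_(y | y != 0) Phi y * (qm ^+ 2 * #|SL|%:R * \sum_x `|f x| ^+ 2) <= _).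
  by apply: ler_sum => y ny; rewrite mulrCA; apply: ler_wpM2l => //; apply: hQ.
rewrite -mulr_suml.
have -> : qm ^+ 2 * (qm ^+ 2 * #|SL|%:R * sqnorm phi * \sum_x `|f x| ^+ 2) =
  (\sum_y Phi y) * (qm ^+ 2 * #|SL|%:R * \sum_x `|f x| ^+ 2) by rewrite sum_sqr_Psi; ring.
apply: ler_wpM2r.
  apply: mulr_ge0; last by apply: sumr_ge0 => x _; rewrite exprn_ge0.
  by apply: mulr_ge0; rewrite ?ler0n // exprn_ge0 // ltW.
by rewrite [X in _ <= X](bigD1 0) //= lerDr.
Qed.
End Bound.
End RowTransvections.

Lemma energy_row_sum (F : finFieldType) m (i : 'I_m.+1) (phi f : 'M[F]_m.+1 -> algC) :
  (1 < m)%N ->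
  (#|F|%:R ^+ m - 1) * (#|F|%:R ^+ m ^+ 2 * energy phi f) <=
  (#|F|%:R ^+ m - 1) * energy (row_sum i phi) f +
  #|F|%:R ^+ m ^+ 2 * #|SLn F m.+1|%:R * sqnorm phi * \sum_x `|f x| ^+ 2.
Proof.
have [chi [c0 cD cN sc]] := nontrivial_additive_character F.
exact: energy_row_sum_char c0 cD cN sc phi f.
Qed.

(** * Matrices with prescribed rows *)

Definition set_row (R : Type) n (x : 'M[R]_n) (i : 'I_n) (v : 'rV[R]_n) : 'M[R]_n :=
  \matrix_(k, l) if k == i then v 0 l else x k l.

Section SetRow.
Variables (R : comPzRingType) (n : nat).
Implicit Types (x y : 'M[R]_n) (i j : 'I_n) (v w : 'rV[R]_n).

Lemma row_set_row x i v : row i (set_row x i v) = v.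
Proof. by apply/rowP => l; rewrite !mxE eqxx. Qed.

Lemma row_set_row_neq x i j v : j != i -> row j (set_row x i v) = row j x.
Proof. by move=> h; apply/rowP => l; rewrite !mxE (negPf h). Qed.

Lemma set_row_id x i : set_row x i (row i x) = x.
Proof. by apply/matrixP => k l; rewrite !mxE; case: eqP => // ->. Qed.

Lemma set_row_set x i v w : set_row (set_row x i v) i w = set_row x i w.
Proof. by apply/matrixP => k l; rewrite !mxE; case: eqP. Qed.

Lemma set_rowC x i j v w : i != j ->
  set_row (set_row x i v) j w = set_row (set_row x j w) i v.
Proof.
move=> h; apply/matrixP => k l; rewrite !mxE; case: (eqVneq k j) => [->|//].
by rewrite eq_sym (negPf h).
Qed.

Lemma set_row_eq x y i : (forall j, j != i -> row j x = row j y) -> y = set_row x i (row i y).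
Proof.
move=> h; apply/matrixP => k l; rewrite !mxE; case: (eqVneq k i) => [->//|ki].
by have /rowP/(_ l) := h k ki; rewrite !mxE.
Qed.

Lemma det_set_row x i v : \det (set_row x i v) = (v *m col i (\adj x)) 0 0.
Proof.
rewrite (expand_det_row _ i) mxE; apply: eq_bigr => l _; rewrite !mxE eqxx; congr (_ * _).
rewrite /cofactor; congr (_ * \det _); apply/matrixP => a b; rewrite !mxE.
by rewrite eq_sym (negPf (neq_lift _ _)).
Qed.

Lemma det_set_row_eq0 x i j : i != j -> \det (set_row x j (row i x)) = 0.
Proof.
move=> h; apply: (@determinant_alternate _ _ _ i j) => // l.
by rewrite !mxE eqxx (negPf h).
Qed.

End SetRow.

Section Counting.
Variable F : finFieldType.
Local Notation q := (#|F|).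

Lemma q_gt1 : (1 < q)%N. Proof. exact: finNzRing_gt1. Qed.

(** The map [(v, w) |-> v + w B] is injective on solutions times [F ^ k], since multiplication by
    [A] recovers [w]. *)
Lemma card_affine n k (A : 'M[F]_(n, k)) (B : 'M[F]_(k, n)) (w0 : 'rV[F]_k) :
  B *m A = 1%:M -> (#|[set v : 'rV[F]_n | v *m A == w0]| * q ^ k <= q ^ n)%N.
Proof.
move=> BA; have -> : (q ^ k = #|[set: 'rV[F]_k]|)%N by rewrite cardsT card_mx mul1n.
have -> : (q ^ n = #|[set: 'rV[F]_n]|)%N by rewrite cardsT card_mx mul1n.
rewrite -cardsX -(@card_in_imset _ _ (fun p => p.1 + p.2 *m B)) ?subset_leq_card ?subsetT //.
move=> [v w] [v' w']; rewrite !inE /= !andbT => /eqP hv /eqP hv' e.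
have /(congr1 (mulmx^~ A)) := e; rewrite !mulmxDl -!mulmxA BA !mulmx1 hv hv' => /addrI ew.
by move: e; rewrite ew => /addIr ->.
Qed.

Lemma card_functional n (a : 'cV[F]_n.+1) : a != 0 ->
  (#|[set v : 'rV[F]_n.+1 | (v *m a) 0%R 0%R == 1%R]| <= q ^ n)%N.
Proof.
move=> na; have [|w hw] := @row_col_mul_eq F n.+1 a^T 1; first by rewrite trmx_eq0.
have hw' : w^T *m a = 1%:M.
  apply/matrixP => s t; rewrite !ord1; move: hw; rewrite !mxE => <-.
  by apply: eq_bigr => j _; rewrite !mxE mulrC.
have := card_affine 1%:M hw'; rewrite expn1 expnS mulnC leq_pmul2l; last exact: ltnW q_gt1.
apply: leq_trans; apply: subset_leq_card; apply/subsetP => v; rewrite !inE => /eqP h.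
by apply/eqP/matrixP => s t; rewrite !ord1 h mxE.
Qed.

(** The rows [p0], [p1] are dual to [a], [b] and certify that the two functionals are
    independent. *)
Lemma card_functional2 n (a b : 'cV[F]_n.+2) (p0 p1 : 'rV[F]_n.+2) (s t : F) :
  (p0 *m a) 0 0 = 1 -> (p0 *m b) 0 0 = 0 -> (p1 *m a) 0 0 = 0 -> (p1 *m b) 0 0 = 1 ->
  (#|[set v : 'rV[F]_n.+2 | ((v *m a) 0 0 == s)%R && ((v *m b) 0 0 == t)%R]| <= q ^ n)%N.
Proof.
move=> h00 h01 h10 h11.
have sc (x : 'M[F]_1) c : x 0 0 = c -> x = c%:M.
  by move=> <-; apply: mx11_scalar.
have BA : col_mx p0 p1 *m row_mx a b = 1%:M.
  rewrite mul_col_row (sc _ _ h00) (sc _ _ h01) (sc _ _ h10) (sc _ _ h11).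
  by rewrite [RHS]scalar_mx_block; congr block_mx; apply/matrixP => ? ?; rewrite !mxE mul0rn.
have := card_affine (row_mx s%:M t%:M) BA.
have e2 : (q ^ n.+2 = q ^ n * q ^ (1 + 1))%N by rewrite -expnD addn2.
rewrite [X in (_ <= X)%N]e2 leq_pmul2r ?expn_gt0 ?(ltnW q_gt1) //.
apply: leq_trans; apply: subset_leq_card; apply/subsetP => v; rewrite !inE => /andP[/eqP h1 /eqP h2].
by rewrite mul_mx_row (sc _ _ h1) (sc _ _ h2).
Qed.

(** If a common solution [p0] exists, it takes the values 1 and 0 on [a] and [b - a]. A row with
    value 1 on [b - a], corrected by a multiple of [p0], completes a dual pair. *)
Lemma card_functional_neq n (a b : 'cV[F]_n.+2) : a != b ->
  (#|[set v : 'rV[F]_n.+2 | ((v *m a) 0 0 == 1)%R && ((v *m b) 0 0 == 1)%R]| <= q ^ n)%N.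
Proof.
move=> nab.
have [->|[p0]] := set_0Vmem [set v : 'rV[F]_n.+2 | ((v *m a) 0 0 == 1) && ((v *m b) 0 0 == 1)].
  by rewrite cards0.
rewrite inE => /andP[/eqP h1 /eqP h2].
have [|w hw] := @row_col_mul_eq F n.+2 (b - a)^T 1.
  by rewrite trmx_eq0 subr_eq0 eq_sym.
have hw' : (w^T *m (b - a)) 0 0 = 1.
  by move: hw; rewrite !mxE => <-; apply: eq_bigr => j _; rewrite !mxE mulrC.
have B00 (x y : 'M[F]_1) : (x - y) 0 0 = x 0 0 - y 0 0 by rewrite !mxE.
have Z00 c (x : 'M[F]_1) : (c *: x) 0 0 = c * x 0 0 by rewrite !mxE.
pose p1 := w^T - (w^T *m a) 0 0 *: p0.
apply: leq_trans (@card_functional2 n a (b - a) p0 p1 1 0 _ _ _ _) => //.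
- apply: subset_leq_card; apply/subsetP => v; rewrite !inE => /andP[/eqP e1 /eqP e2].
  by rewrite e1 mulmxBr B00 e2 e1 subrr !eqxx.
- by rewrite mulmxBr B00 h2 h1 subrr.
- by rewrite mulmxBl B00 -scalemxAl Z00 h1 mulr1 subrr.
- by rewrite mulmxBl B00 hw' -scalemxAl Z00 mulmxBr B00 h2 h1 subrr mulr0 subr0.
Qed.

Variable n : nat.
Implicit Types (x y z : 'M[F]_n) (J : {set 'I_n}).
Local Notation SL := (SLn F n).

Definition agree J x y := [forall i in J, row i x == row i y].

Lemma agreeP J x y : reflect (forall i, i \in J -> row i x = row i y) (agree J x y).
Proof. by apply: (iffP forall_inP) => h i /h /eqP. Qed.

Lemma agree_sym J x y : agree J x y = agree J y x.
Proof. by apply/agreeP/agreeP => h i /h. Qed.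

Lemma card_rows (P : 'I_n -> pred 'rV[F]_n) :
  (#|[set y : 'M[F]_n | [forall i, P i (row i y)]]| <= \prod_i #|P i|)%N.
Proof.
have -> : (\prod_i #|P i| = #|family P|)%N by rewrite card_family foldrE big_map big_enum.
have inj : injective (fun y : 'M[F]_n => [ffun i => row i y]).
  by move=> y z /ffunP h; apply/row_matrixP => i; have := h i; rewrite !ffunE.
rewrite -(card_imset _ inj); apply: subset_leq_card; apply/subsetP => g /imsetP[y].
by rewrite inE => /forallP h ->; apply/familyP => i; rewrite ffunE; apply: h.
Qed.

End Counting.

(** The determinant is linear in row [i], with the cofactors as coefficients: either they all vanish
    and there is no solution, or the solutions form an affine hyperplane. *)
Lemma card_SL_row (F : finFieldType) n (x : 'M[F]_n.+1) (i : 'I_n.+1) :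
  (#|[set v : 'rV[F]_n.+1 | \det (set_row x i v) == 1%R]| <= #|F| ^ n)%N.
Proof.
case: (eqVneq (col i (\adj x)) 0) => [e|ne].
  rewrite [X in (X <= _)%N](_ : _ = 0%N) //; apply/eqP; rewrite cards_eq0.
  apply/eqP/setP => v; rewrite !inE det_set_row e mulmx0 mxE eq_sym; exact/negbTE/oner_neq0.
apply: leq_trans (card_functional ne); apply: subset_leq_card.
by apply/subsetP => v; rewrite !inE det_set_row.
Qed.

(** All rows outside [J] but one are free; the last one, [i0], satisfies a linear equation, which
    saves one factor of [q]. *)
Lemma card_completions (F : finFieldType) n (J : {set 'I_n.+1}) (x : 'M[F]_n.+1) :
  (#|J| <= n)%N ->
  (#|[set y in SLn F n.+1 | agree J x y]| <= #|F| ^ (n.+1 * (n.+1 - #|J|) - 1))%N.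
Proof.
move=> hJ.
have [i0 ni0] : exists i, i \notin J.
  have /card_gt0P[i] : (0 < #|~: J|)%N by rewrite cardsCs setCK card_ord; lia.
  by rewrite inE; exists i.
pose zer (y : 'M[F]_n.+1) := set_row y i0 0.
pose T := [set y : 'M[F]_n.+1 | [forall i, if i \in i0 |: J then row i y == row i (zer x) else true]].
have cT : (#|T| <= #|F| ^ (n.+1 * (n.+1 - #|J|.+1)))%N.
  pose P i : pred 'rV[F]_n.+1 := fun v => if i \in i0 |: J then v == row i (zer x) else true.
  apply: leq_trans (card_rows P) _.
  rewrite (bigID (mem (i0 |: J))) /= big1 => [|i hi]; last first.
    transitivity #|pred1 (row i (zer x))|; last exact: card1.
    by apply: eq_card => v; rewrite [LHS]unfold_in /P hi inE.
  rewrite mul1n (eq_bigr (fun=> #|F| ^ n.+1)%N) => [|i hi]; last first.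
    have := card_mx F 1 n.+1; rewrite mul1n => <-.
    by apply: eq_card => v; rewrite [LHS]unfold_in /P (negPf hi).
  rewrite prod_nat_const -expnM leq_eqVlt; apply/orP; left; apply/eqP; congr (_ ^ (_ * _))%N.
  rewrite (eq_card (B := ~: (i0 |: J))) => [|i]; last by rewrite [LHS]unfold_in [RHS]inE.
  by rewrite cardsCs setCK card_ord cardsU1 ni0 add1n.
rewrite -sum1_card (partition_big zer (mem T)) /= => [|y]; last first.
  rewrite !inE => /andP[_ /agreeP h]; apply/forallP => i; case: ifP => //.
  rewrite !inE; case: (eqVneq i i0) => [-> _|ni /= /h e]; first by rewrite !row_set_row.
  by rewrite !row_set_row_neq // e.
apply: leq_trans (_ : \sum_(y in T) #|F| ^ n <= _)%N.
  apply: leq_sum => y _; apply: leq_trans (card_SL_row y i0); rewrite sum1_card.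
  have inj : {in [pred z | (z \in [set y0 in SLn F n.+1 | agree J x y0]) && (zer z == y)] &,
     injective (row i0)}.
    move=> z z'; rewrite !inE => /andP[_ /eqP hz] /andP[_ /eqP hz'] e.
    rewrite -(set_row_id z i0) -(set_row_id z' i0) -(set_row_set z i0 0) -/(zer z) hz.
    by rewrite -(set_row_set z' i0 0) -/(zer z') hz' e.
  rewrite -(card_in_imset inj); apply: subset_leq_card; apply/subsetP => v /imsetP[z].
  rewrite !inE => /andP[/andP[dz _] /eqP hz] ->.
  by rewrite -hz /zer set_row_set set_row_id.
rewrite sum_nat_const; apply: leq_trans (leq_mul cT (leqnn _)) _.
rewrite -expnD leq_exp2l ?q_gt1 //; move: hJ; move: #|J| => k hk.
have -> : (n.+1 - k = (n.+1 - k.+1).+1)%N by lia.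
by rewrite mulnS; lia.
Qed.

Lemma agree_trans (F : finFieldType) n (J : {set 'I_n}) (x y z : 'M[F]_n) :
  agree J x y -> agree J y z -> agree J x z.
Proof. by move=> /agreeP h /agreeP h'; apply/agreeP => i iJ; rewrite h // h'. Qed.

Lemma agreeS (F : finFieldType) n (J K : {set 'I_n}) (x y : 'M[F]_n) :
  J \subset K -> agree K x y -> agree J x y.
Proof. by move=> /subsetP s /agreeP h; apply/agreeP => i /s /h. Qed.

Lemma agreeU (F : finFieldType) n (J K : {set 'I_n}) (x y : 'M[F]_n) :
  agree J x y -> agree K x y -> agree (J :|: K) x y.
Proof.
move=> /agreeP h /agreeP h'; apply/agreeP => i; rewrite inE.
by case/orP => [/h|/h'].
Qed.

Lemma agreeC1 (F : finFieldType) n (i : 'I_n) (x y : 'M[F]_n) :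
  agree (~: [set i]) x y -> y = set_row x i (row i y).
Proof. by move=> /agreeP h; apply: set_row_eq => j ji; apply: h; rewrite !inE. Qed.

(** An intermediate [y] takes row [j] from [x], row [i] from [z] and the rows in [J] from both, so
    it completes [#|J| + 2] prescribed rows; the bound on [#|J|] leaves a row to carry the
    determinant condition. *)
Lemma card_two_step (F : finFieldType) n (J : {set 'I_n.+1}) (i j : 'I_n.+1) (x z : 'M[F]_n.+1) :
  i \notin J -> j \notin J -> i != j -> (#|J| + 2 <= n)%N ->
  (#|[set y in SLn F n.+1 | agree (j |: J) x y && agree (i |: J) y z]| <=
     agree J x z * #|F| ^ (n.+1 * (n.+1 - (#|J| + 2)) - 1))%N.
Proof.
move=> iJ jJ ij hJ.
have cJ : #|i |: (j |: J)| = (#|J| + 2)%N.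
  by rewrite !cardsU1 jJ !inE (negPf ij) iJ addn2.
set Y := [set y in _ | _]; have [->|[y0]] := set_0Vmem Y; first by rewrite cards0.
rewrite !inE => /and3P[_ h1 h2].
have -> : agree J x z.
  by apply: (@agree_trans _ _ _ _ y0); [apply: agreeS h1|apply: agreeS h2]; exact: subsetUr.
rewrite mul1n -cJ; apply: leq_trans (card_completions y0 _); last by rewrite cJ.
apply: subset_leq_card; apply/subsetP => y; rewrite !inE => /and3P[-> h3 h4] /=.
have -> : i |: (j |: J) = (i |: J) :|: (j |: J).
  by rewrite -setUA [J :|: _]setUC -setUA setUid.
apply: agreeU; first by apply: agree_trans h2 _; rewrite agree_sym.
by apply: agree_trans h3; rewrite agree_sym.
Qed.

Section FourStep.
Variables (F : finFieldType) (n : nat) (i j : 'I_n.+2) (x z : 'M[F]_n.+2).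
Hypothesis ij : i != j.
Hypothesis xSL : \det x = 1.
Local Notation q := (#|F|).
Local Notation SL := (SLn F n.+2).

(* [r] and [row i x] define the same functional on row [j] only if they differ by
   a vector of the radical of the form [(r, p) |-> \det] of [x] with rows [i], [j]
   replaced by [r], [p], which has codimension 2. *)
Lemma card_radical :
  (#|[set r : 'rV[F]_n.+2 | col j (\adj (set_row x i r)) == col j (\adj x)]| <= q ^ n)%N.
Proof.
have ji : j != i by rewrite eq_sym.
pose c := col i (\adj x); pose d := col i (\adj (set_row x j (row i x))).
have hc v : (v *m c) 0 0 = \det (set_row x i v) by rewrite det_set_row.
have hd v : (v *m d) 0 0 = \det (set_row (set_row x j (row i x)) i v) by rewrite det_set_row.
have e00 : (row i x *m c) 0 0 = 1 by rewrite hc set_row_id.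
have e01 : (row i x *m d) 0 0 = 0.
  by rewrite hd -set_rowC // set_row_id det_set_row_eq0.
have e10 : (- row j x *m c) 0 0 = 0 by rewrite mulNmx mxE hc det_set_row_eq0 // oppr0.
(* Exchanging rows [i] and [j] reverses the sign of the determinant, hence the sign in front of
   [row j x]. *)
have e11 : (- row j x *m d) 0 0 = 1.
  rewrite mulNmx mxE hd.
  have -> : set_row (set_row x j (row i x)) i (row j x) = xrow i j x.
    apply/matrixP => k l; rewrite !mxE; case: (eqVneq k i) => [->|ki]; first by rewrite tpermL.
    by case: (eqVneq k j) => [->|kj]; rewrite ?tpermR // tpermD // eq_sym.
  by rewrite xrowE det_mulmx det_perm odd_tperm ij xSL mulr1 expr1 opprK.
apply: leq_trans (@card_functional2 F n c d _ _ 1 0 e00 e01 e10 e11).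
apply: subset_leq_card; apply/subsetP => r; rewrite !inE => /eqP e; rewrite hc hd.
have h v : \det (set_row (set_row x i r) j v) = \det (set_row x j v) by rewrite !det_set_row e.
apply/andP; split.
  by rewrite -[set_row x i r](@set_row_id _ _ _ j) h row_set_row_neq // set_row_id xSL.
by rewrite -set_rowC // h det_set_row_eq0.
Qed.

(** For [r] in the radical, at most [q ^ n] choices, the two equations on [p] coincide and leave
    [q ^ n.+1] solutions. For other [r] they are distinct and leave [q ^ n], while the third
    condition leaves [q ^ n.+1] choices of [r]. *)
Lemma card_pairs (v : 'rV[F]_n.+2) :
  (\sum_(r : 'rV[F]_n.+2) \sum_(p : 'rV[F]_n.+2)
    [&& \det (set_row x j p) == 1%R, \det (set_row (set_row x i r) j p) == 1%R &
        \det (set_row (set_row x i r) j v) == 1%R] <= 2 * q ^ (2 * n + 1))%N.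
Proof.
have h2 : (\sum_(r : 'rV[F]_n.+2 | \det (set_row (set_row x j v) i r) == 1%R) q ^ n <= q ^ (2 * n + 1))%N.
  rewrite sum_nat_const; apply: leq_trans (leq_mul (_ : _ <= q ^ n.+1)%N (leqnn _)) _.
    by rewrite -cardsE; apply: card_SL_row.
  by rewrite -expnD leq_exp2l ?q_gt1 //; lia.
pose rad := [set r : 'rV[F]_n.+2 | col j (\adj (set_row x i r)) == col j (\adj x)].
have h1 : (\sum_(r in rad) q ^ n.+1 <= q ^ (2 * n + 1))%N.
  rewrite sum_nat_const; apply: leq_trans (leq_mul card_radical (leqnn _)) _.
  by rewrite -expnD leq_exp2l ?q_gt1 //; lia.
rewrite mul2n -addnn; apply: leq_trans (leq_add h1 h2).
rewrite [X in (_ <= X + _)%N]big_mkcond [X in (_ <= _ + X)%N]big_mkcond -big_split /=; apply: leq_sum => r _.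
rewrite -(set_rowC x r v ij).
case: (\det (set_row (set_row x i r) j v) == 1); last first.
  by rewrite big1 // => p _; rewrite !andbF.
rewrite (eq_bigr (fun p : 'rV[F]_n.+2 =>
  (((p *m col j (\adj x)) 0%R 0%R == 1%R) && ((p *m col j (\adj (set_row x i r))) 0%R 0%R == 1%R)) : nat)); last first.
  by move=> p _; rewrite !det_set_row andbT.
rewrite inE; case: eqVneq => [->|ne].
  apply: leq_trans (leq_addr _ _).
  apply: leq_trans (card_SL_row x j); rewrite -sum1_card [X in (_ <= X)%N]big_mkcond /=.
  by apply: leq_sum => p _; rewrite andbb inE det_set_row; case: ifP.
rewrite add0n; rewrite eq_sym in ne; apply: leq_trans (card_functional_neq ne).
rewrite -sum1_card [X in (_ <= X)%N]big_mkcond /=.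
by apply: leq_sum => p _; rewrite inE; case: ifP.
Qed.

(** A path from [x] to [z] changing rows [j], [i], [j], [i] in turn is determined by the first new
    row [j] and the first new row [i], since the second new row [j] is already that of [z]. The
    determinant conditions on the three intermediate matrices are those of [card_pairs]. *)
Lemma card_four_step :
  (#|[set t : 'M[F]_n.+2 * 'M[F]_n.+2 * 'M[F]_n.+2 |
      [&& t.1.1 \in SL, t.1.2 \in SL & t.2 \in SL] &&
      [&& agree (~: [set j]) x t.1.1, agree (~: [set i]) t.1.1 t.1.2,
          agree (~: [set j]) t.1.2 t.2 & agree (~: [set i]) t.2 z]]| <=
   agree (~: [set i; j]) x z * (2 * q ^ (2 * n + 1)))%N.
Proof.
have si : ~: [set i; j] \subset ~: [set i] by rewrite setCS sub1set !inE eqxx.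
have sj : ~: [set i; j] \subset ~: [set j] by rewrite setCS sub1set !inE eqxx orbT.
set Y := [set t | _]; have [->|[[[y1 y2] y3]]] := set_0Vmem Y; first by rewrite cards0.
rewrite inE /= => /andP[_ /and4P[a1 a2 a3 a4]].
have -> : agree (~: [set i; j]) x z.
  apply: agree_trans (agreeS sj a1) _; apply: agree_trans (agreeS si a2) _.
  by apply: agree_trans (agreeS sj a3) _; exact: agreeS si a4.
rewrite mul1n; apply: leq_trans (card_pairs (row j z)); rewrite pair_big /=.
pose g (t : 'M[F]_n.+2 * 'M[F]_n.+2 * 'M[F]_n.+2) := (row i t.1.2, row j t.1.1).
have desc t : t \in Y -> [/\ t.1.1 = set_row x j (row j t.1.1),
    t.1.2 = set_row (set_row x i (row i t.1.2)) j (row j t.1.1) &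
    t.2 = set_row (set_row x i (row i t.1.2)) j (row j z)].
  case: t => [[t1 t2] t3]; rewrite inE /= => /andP[_ /and4P[b1 b2 b3 b4]].
  have e1 := agreeC1 b1; have e2 := agreeC1 b2; have e3 := agreeC1 b3.
  have e2' : t2 = set_row (set_row x i (row i t2)) j (row j t1).
    by rewrite {1}e2 {1}e1 -set_rowC.
  split=> //; rewrite {1}e3 e2' set_row_set.
  have /agreeP/(_ j) := b4; rewrite !inE eq_sym ij => /(_ isT) ->.
  rewrite row_set_row_neq // row_set_row //.
have inj : {in Y &, injective g}.
  move=> t s tY sY [e1 e2]; have [h1 h2 h3] := desc t tY; have [k1 k2 k3] := desc s sY.
  move: h1 h2 h3 k1 k2 k3; rewrite e1 e2.
  by case: t s {tY sY e1 e2} => [[? ?] ?] [[? ?] ?] /= <- <- <- -> -> ->.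
rewrite -(card_in_imset inj) -sum1_card big_mkcond /=; apply: leq_sum => -[r p] _ /=.
case: ifP => // /imsetP[t tY [-> ->]]; have [h1 h2 h3] := desc t tY.
move: tY; rewrite inE => /andP[/and3P[]]; rewrite !inSLn => d1 d2 d3 _.
by rewrite -h1 -h2 -h3 d1 d2 d3.
Qed.

End FourStep.

(** * Quasirandomness of the special linear group *)

Section Averages.
Variables (F : finFieldType) (m : nat).
Local Notation n := m.+1.
Local Notation q := (#|F|).
Local Notation SL := (SLn F n).
Local Notation fn := ('M[F]_n -> algC).
Implicit Types (phi psi f : fn) (J : {set 'I_n}).

Definition nonneg phi := forall x, 0 <= phi x.
Definition l2norm f := \sum_x `|f x| ^+ 2.
Definition gap : algC := #|SL|%:R / (q%:R ^+ m - 1).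

Lemma nonneg_inner phi f h : nonneg phi -> nonneg f -> 0 <= inner phi f h.
Proof. by move=> p0 f0; apply: sumr_ge0 => x _; apply: mulr_ge0. Qed.

Lemma energy_ge0 phi f : 0 <= energy phi f.
Proof. by apply: sumr_ge0 => h _; rewrite exprn_ge0. Qed.

Lemma sqnorm_ge0 phi : 0 <= sqnorm phi.
Proof. by apply: sumr_ge0 => h _; rewrite exprn_ge0. Qed.

Lemma l2norm_ge0 phi : 0 <= l2norm phi.
Proof. by apply: sumr_ge0 => h _; rewrite exprn_ge0. Qed.

Lemma q_gt0 : 0 < (q%:R : algC).
Proof. by rewrite ltr0n; apply: ltnW (q_gt1 F). Qed.

Lemma qk_neq0 k : (q%:R ^+ k : algC) != 0.
Proof. by rewrite expf_neq0 // lt0r_neq0 // q_gt0. Qed.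

Lemma gap_ge0 : 0 <= gap.
Proof.
rewrite /gap mulr_ge0 ?ler0n // invr_ge0 subr_ge0 exprn_ege1 // ler1n.
exact: ltnW (q_gt1 F).
Qed.

Lemma error_ge0 phi f : 0 <= gap * sqnorm phi * l2norm f.
Proof. by rewrite mulr_ge0 ?l2norm_ge0 // mulr_ge0 ?gap_ge0 ?sqnorm_ge0. Qed.

Lemma energy_le phi psi f (c : algC) : nonneg phi -> nonneg f -> 0 <= c ->
  {in SL, forall x, phi x <= c * psi x} -> energy phi f <= c ^+ 2 * energy psi f.
Proof.
move=> p0 f0 c0 h; rewrite /energy mulr_sumr; apply: ler_sum => y _.
have h1 : inner phi f y <= c * inner psi f y.
  rewrite /inner mulr_sumr; apply: ler_sum => x xS; rewrite mulrA.
  by apply: ler_wpM2r; rewrite ?f0 // h.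
have h2 := le_trans (nonneg_inner y p0 f0) h1.
rewrite [`|inner phi f y|]ger0_norm ?nonneg_inner //.
apply: le_trans (_ : (c * inner psi f y) ^+ 2 <= _).
  by rewrite lerXn2r // nnegrE ?nonneg_inner.
by rewrite -[c * _]ger0_norm // normrM exprMn [`|c|]ger0_norm.
Qed.

Lemma ler_sum_inj (T : finType) phi (g : T -> 'M[F]_n) (P : pred 'M[F]_n) :
  nonneg phi -> injective g -> (forall w, P (g w)) ->
  \sum_w phi (g w) <= \sum_(y | P y) phi y.
Proof.
move=> p0 inj hP; rewrite -(big_imset (h := g) (A := predT) phi (in2W inj)) /=.
rewrite big_mkcond [X in _ <= X]big_mkcond; apply: ler_sum => y _.
case: ifP => [/imsetP[w _ ->]|_]; first by rewrite hP.
by case: ifP.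
Qed.

(* [q ^ (n * (n - #|J|) - 1)] only bounds the number of completions of the rows
   in [J] from above: [avg J] is a contraction rather than an exact average. *)
Definition avg J phi : fn := fun x =>
  q%:R ^- (n * (n - #|J|) - 1) * \sum_(y in SL | agree J x y) phi y.

Lemma avg_nonneg J phi : nonneg phi -> nonneg (avg J phi).
Proof.
move=> p0 x; apply: mulr_ge0; last by apply: sumr_ge0 => y _; apply: p0.
by rewrite invr_ge0 exprn_ge0 // ler0n.
Qed.

(** Cauchy-Schwarz inside each average, then exchange of sums: the relation [agree J] is symmetric,
    so [card_completions] bounds the kernel in both variables. *)
Lemma avg_contraction J phi : (#|J| <= m)%N -> nonneg phi -> sqnorm (avg J phi) <= sqnorm phi.
Proof.
move=> hJ p0; rewrite /sqnorm /avg; set Q := _ ^- _.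
have Q0 : 0 < Q by rewrite invr_gt0 exprn_gt0 // q_gt0.
have cnt x : Q * #|[set y in SL | agree J x y]|%:R <= 1.
  rewrite mulrC ler_pdivrMr ?exprn_gt0 ?q_gt0 // mul1r -natrX ler_nat.
  exact: card_completions.
apply: le_trans (_ : \sum_(x in SL) Q * \sum_(y in SL | agree J x y) `|phi y| ^+ 2 <= _).
  apply: ler_sum => x _; rewrite normrM exprMn [`|Q|]gtr0_norm //.
  rewrite expr2 -mulrA; apply: ler_wpM2l; first exact: ltW.
  have := cauchy_schwarz_cond (fun y => (y \in SL) && agree J x y) (fun=> 1) phi.
  rewrite (eq_bigr phi) => [|y _]; last by rewrite mul1r.
  move=> /(ler_wpM2l (ltW Q0)) /le_trans; apply; rewrite mulrA.
  rewrite -[X in _ <= X]mul1r; apply: ler_wpM2r; first by apply: sumr_ge0 => y _; rewrite exprn_ge0.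
  apply: le_trans (cnt x); rewrite normr1 expr1n sumr_const -mulr_natl mulr1.
  by rewrite (eq_card (B := [set y in SL | agree J x y])) // => y; rewrite [RHS]inE.
rewrite -mulr_sumr (exchange_big_dep (mem SL)) /=; last by move=> x y _ /andP[].
rewrite mulr_sumr; apply: ler_sum => y yS.
rewrite sumr_const -mulr_natl mulrA; apply: ler_piMl; first by rewrite exprn_ge0.
apply: le_trans (cnt y).
by rewrite (eq_card (B := [set x in SL | agree J y x])) // => x; rewrite [RHS]inE [LHS]unfold_in yS agree_sym.
Qed.

(** Replacing [phi] by [T phi] costs a gap term and a factor [K]. Contraction keeps the gap term
    under control when operators are composed. *)
Definition good (T : fn -> fn) (K : nat) := [/\ forall phi, nonneg phi -> nonneg (T phi),
  forall phi, nonneg phi -> sqnorm (T phi) <= sqnorm phi &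
  forall phi f, nonneg phi -> nonneg f ->
    energy phi f <= K%:R * (energy (T phi) f + gap * sqnorm phi * l2norm f)].

(** The error of the second step is measured at [T1 phi], whose norm is no larger than that of
    [phi]; the successor in [K2.+1] pays for the error of the first step. *)
Lemma good_comp T1 T2 K1 K2 : good T1 K1 -> good T2 K2 ->
  good (fun phi => T2 (T1 phi)) (K1 * K2.+1).
Proof.
move=> [n1 c1 e1] [n2 c2 e2]; split=> [phi p0|phi p0|phi f p0 f0].
- by apply: n2; apply: n1.
- by apply: le_trans (c2 _ _) (c1 _ _) => //; apply: n1.
apply: le_trans (e1 _ _ p0 f0) _; rewrite natrM -[X in _ <= X]mulrA; apply: ler_wpM2l; first exact: ler0n.
set E2 := energy (T2 _) _; set g := gap * _ * _.
have g0 : 0 <= g by apply: error_ge0.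
have : energy (T1 phi) f <= K2%:R * (E2 + g).
  apply: le_trans (e2 _ _ (n1 _ p0) f0) _; apply: ler_wpM2l; first exact: ler0n.
  rewrite lerD2l; apply: ler_wpM2r; first exact: l2norm_ge0.
  by apply: ler_wpM2l; [exact: gap_ge0|exact: c1].
move=> h; apply: le_trans (lerD h (lexx g)) _.
by rewrite -natr1 mulrDl mul1r lerD2l lerDr; apply: energy_ge0.
Qed.

Lemma good_avg_dominated T K J (c : nat) : good T K -> (#|J| <= m)%N -> (0 < c)%N ->
  (forall phi, nonneg phi -> {in SL, forall x, T phi x <= c%:R * avg J phi x}) ->
  good (avg J) (K * c ^ 2).
Proof.
move=> [n1 c1 e1] hJ c0 h; split=> [phi p0|phi p0|phi f p0 f0].
- exact: avg_nonneg.
- exact: avg_contraction.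
apply: le_trans (e1 _ _ p0 f0) _; rewrite natrM -[X in _ <= X]mulrA; apply: ler_wpM2l; first exact: ler0n.
rewrite mulrDr; apply: lerD.
  by rewrite natrX; apply: energy_le; rewrite ?ler0n //; [exact: n1|exact: h].
apply: ler_peMl; first exact: error_ge0.
by rewrite ler1n expn_gt0 c0.
Qed.

(** The [q ^ m] transvections carry [x] to distinct matrices of determinant 1 that differ from [x]
    in row [i] only, so the row sum is at most [q ^ m] times the average. *)
Lemma good_base i : (1 < m)%N -> good (avg (~: [set i])) 1.
Proof.
move=> m1.
have cJ : #|~: [set i]| = m by rewrite cardsCs setCK card_ord cards1 subn1.
split=> [phi p0|phi p0|phi f p0 f0].
- exact: avg_nonneg.
- by apply: avg_contraction; rewrite ?cJ.
rewrite mul1r.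
have Q0 : 0 < (q%:R ^+ m : algC) by rewrite exprn_gt0 // q_gt0.
have Q1 : 0 < (q%:R ^+ m - 1 : algC).
  by rewrite subr_gt0 -natrX ltr1n -(exp1n m) ltn_exp2r ?q_gt1 //; apply: ltnW.
have := energy_row_sum i phi f m1; rewrite -/(l2norm f) => h.
have h1 : energy (row_sum i phi) f <= (q%:R ^+ m) ^+ 2 * energy (avg (~: [set i]) phi) f.
  apply: energy_le => //; first by move=> x; apply: sumr_ge0 => w _; apply: p0.
    exact: ltW.
  move=> x xS; rewrite /avg cJ subSnn muln1 subn1 /= mulrA divff ?mul1r; last exact: lt0r_neq0.
  rewrite /row_sum.
  have ux : x \in unitmx by rewrite unitmxE; move: xS; rewrite inSLn => /eqP ->; rewrite unitr1.
  have inj : injective (fun w : 'rV[F]_m => row_transv i w *m x).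
    move=> w w' /(congr1 (mulmx^~ (invmx x))); rewrite !mulmxK // => /addrI.
    move=> /(congr1 (mulmx (delta_mx 0 i : 'rV[F]_n))) /=; rewrite !mulmxA !mul_delta_mx.
    have -> : delta_mx 0 0 = 1%:M :> 'M[F]_1 by apply/matrixP => a b; rewrite !ord1 !mxE.
    rewrite !mul1mx => /(congr1 (mulmx^~ (row' i 1%:M)^T)).
    by rewrite -!mulmxA row_incl_mul_tr !mulmx1.
  apply: (ler_sum_inj p0 inj) => w; rewrite transv_SL xS /=.
  apply/agreeP => k; rewrite !inE => ki; apply/rowP => l.
  rewrite /row_transv mulmxDl mul1mx -mulmxA [LHS]mxE [RHS]mxE [RHS]mxE -[LHS]addr0.
  congr (_ + _); rewrite mxE big1 // => b _.
  by rewrite [delta_mx _ _ _ _]mxE (negPf ki) mul0r.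
have : (q%:R ^+ m - 1) * (q%:R ^+ m ^+ 2 * energy phi f) <=
  (q%:R ^+ m - 1) * (q%:R ^+ m ^+ 2 * (energy (avg (~: [set i]) phi) f + gap * sqnorm phi * l2norm f)).
  apply: le_trans h _; rewrite !mulrDr; apply: lerD.
    by apply: ler_wpM2l => //; exact: ltW.
  rewrite le_eqVlt; apply/orP; left; apply/eqP; rewrite /gap.
  by field; exact: lt0r_neq0.
by rewrite ler_pM2l // ler_pM2l // exprn_gt0.
Qed.

End Averages.

(** * Compositions of averages dominated by a coarser average *)

Section Domination.
Variables (F : finFieldType) (m : nat).
Local Notation n := m.+1.
Local Notation q := (#|F|).
Local Notation SL := (SLn F n).
Local Notation fn := ('M[F]_n -> algC).
Implicit Types (phi : fn) (J : {set 'I_n}).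

Definition kern J (x y : 'M[F]_n) : algC := ((y \in SL) && agree J x y)%:R.

Lemma avgE J phi x :
  avg J phi x = q%:R ^- (n * (n - #|J|) - 1) * \sum_y kern J x y * phi y.
Proof.
rewrite /avg big_mkcond; congr (_ * _); apply: eq_bigr => y _.
by rewrite /kern; case: ifP => _; rewrite ?mul1r ?mul0r.
Qed.

(** The two normalisations and the path count of [card_two_step] balance exactly, whence the
    constant 1. *)
Lemma avg_two_step J i j phi x : i \notin J -> j \notin J -> i != j -> (#|J| + 2 <= m)%N ->
  nonneg phi -> avg (j |: J) (avg (i |: J) phi) x <= 1%:R * avg J phi x.
Proof.
move=> iJ jJ ij hJ p0; rewrite mul1r !avgE cardsU1 jJ.
set k := #|J| in hJ *; set Q := q%:R ^- (n * (n - (true + k)) - 1) : algC.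
have Q0 : 0 <= Q by rewrite invr_ge0 exprn_ge0 // ler0n.
have -> : Q * \sum_y kern (j |: J) x y * avg (i |: J) phi y =
    Q ^+ 2 * \sum_z (\sum_y kern (j |: J) x y * kern (i |: J) y z) * phi z.
  rewrite expr2 -mulrA; congr (_ * _).
  rewrite (eq_bigr (fun y => \sum_z Q * (kern (j |: J) x y * kern (i |: J) y z * phi z))) => [|y _].
    rewrite exchange_big mulr_sumr; apply: eq_bigr => z _ /=.
    by rewrite mulr_suml mulr_sumr.
  rewrite avgE cardsU1 iJ mulrCA mulr_sumr mulr_sumr; apply: eq_bigr => z _.
  by rewrite !mulrA.
have cnt z : \sum_y kern (j |: J) x y * kern (i |: J) y z <=
    kern J x z * (q ^ (n * (n - (k + 2)) - 1))%:R.
  rewrite /kern; case zS : (z \in SL); last first.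
    by rewrite mul0r big1 // => y _; rewrite mulr0.
  rewrite -natrM; apply: le_trans (_ : #|[set y in SL | agree (j |: J) x y && agree (i |: J) y z]|%:R <= _).
    rewrite -sum1_card natr_sum [X in _ <= X]big_mkcond /=; apply: ler_sum => y _.
    by rewrite !inE /= -natrM mulnb -andbA; case: ifP.
  by rewrite ler_nat; apply: card_two_step.
apply: le_trans (_ : Q ^+ 2 * \sum_z (kern J x z * (q ^ (n * (n - (k + 2)) - 1))%:R) * phi z <= _).
  apply: ler_wpM2l; first by rewrite exprn_ge0.
  by apply: ler_sum => z _; apply: ler_wpM2r.
rewrite le_eqVlt; apply/orP; left; apply/eqP.
rewrite (eq_bigr (fun z => (q ^ (n * (n - (k + 2)) - 1))%:R * (kern J x z * phi z))) => [|z _]; last first.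
  by rewrite mulrAC mulrC.
rewrite -mulr_sumr mulrA; congr (_ * _); rewrite /Q natrX.
have e : (2 * (n * (n - (true + k)) - 1) = (n * (n - k) - 1) + (n * (n - (k + 2)) - 1))%N.
  have [d hd] : exists d, n = (k + 3 + d)%N by exists (n - (k + 3))%N; lia.
  rewrite hd /=.
  have -> : (k + 3 + d - k = d + 3)%N by lia.
  have -> : (k + 3 + d - (k + 2) = d + 1)%N by lia.
  have -> : (k + 3 + d - (true + k) = d + 2)%N by rewrite -[nat_of_bool true]/1%N; lia.
  have h1 : (0 < (k + 3 + d) * (d + 1))%N by rewrite muln_gt0; lia.
  by rewrite !mulnDr; lia.
by rewrite exprVn -exprM mulnC e exprD invfM -mulrA mulVf ?mulr1 ?qk_neq0.
Qed.

End Domination.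

Section FourStepDomination.
Variables (F : finFieldType) (m : nat).
Local Notation n := m.+2.
Local Notation q := (#|F|).
Local Notation SL := (SLn F n).
Local Notation fn := ('M[F]_n -> algC).

(* With [i] and [j] the only free rows, two steps do not suffice: resampling row
   [j] and then row [i] reaches some matrices with a probability too large by a
   factor [q], since the determinant condition is used up by a single row.
   Repeating both steps removes these atoms. *)
Lemma avg_four_step i j (phi : fn) x : i != j -> nonneg phi -> x \in SL ->
  avg (~: [set j]) (avg (~: [set i]) (avg (~: [set j]) (avg (~: [set i]) phi))) x
    <= 2%:R * avg (~: [set i; j]) phi x.
Proof.
move=> ij p0 xS.
have c1 (a : 'I_n) : #|~: [set a]| = m.+1 by rewrite cardsCs setCK card_ord cards1 subn1.
have c2 : #|~: [set i; j]| = m by rewrite cardsCs setCK card_ord cards2 ij subn2.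
pose Q : algC := q%:R ^- m.+1.
have aE (a : 'I_n) (psi : fn) (y : 'M[F]_n) : avg (~: [set a]) psi y = Q * \sum_z kern (~: [set a]) y z * psi z.
  have h : (m.+2 * (m.+2 - m.+1) - 1 = m.+1)%N by lia.
  by rewrite avgE c1 h.
have r3 (a b : algC) : a * (Q * (Q * b)) = Q ^+ 2 * (a * b) by ring.
pose k1 := @kern F m.+1 (~: [set j]); pose k2 := @kern F m.+1 (~: [set i]).
have e2 : forall (g : fn) (y : 'M[F]_n), avg (~: [set i]) (avg (~: [set j]) (avg (~: [set i]) g)) y =
    Q ^+ 3 * \sum_(z : 'M[F]_n) (\sum_(y2 : 'M[F]_n) \sum_(y3 : 'M[F]_n) k2 y y2 * k1 y2 y3 * k2 y3 z) * g z.
  move=> g y.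
  rewrite aE (eq_bigr (fun y2 => Q ^+ 2 * \sum_(z : 'M[F]_n) (\sum_(y3 : 'M[F]_n) k2 y y2 * k1 y2 y3 * k2 y3 z) * g z)) => [|y2 _].
    rewrite -mulr_sumr mulrA -exprS; congr (_ * _); rewrite exchange_big; apply: eq_bigr => z _ /=.
    by rewrite mulr_suml.
  rewrite aE (eq_bigr (fun y3 => Q * \sum_(z : 'M[F]_n) (k1 y2 y3 * k2 y3 z) * g z)) => [|y3 _].
    rewrite -mulr_sumr r3; congr (_ * _).
    rewrite exchange_big mulr_sumr; apply: eq_bigr => z _ /=.
    by rewrite !mulr_suml mulr_sumr; apply: eq_bigr => y3 _; rewrite !mulrA.
  by rewrite aE mulrCA mulr_sumr; congr (_ * _); apply: eq_bigr => z _; rewrite mulrA.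
have -> : avg (~: [set j]) (avg (~: [set i]) (avg (~: [set j]) (avg (~: [set i]) phi))) x =
    Q ^+ 4 * \sum_(z : 'M[F]_n) (\sum_(y1 : 'M[F]_n) \sum_(y2 : 'M[F]_n) \sum_(y3 : 'M[F]_n) k1 x y1 * k2 y1 y2 * k1 y2 y3 * k2 y3 z) * phi z.
  rewrite aE (eq_bigr (fun y1 => Q ^+ 3 * \sum_(z : 'M[F]_n) (\sum_(y2 : 'M[F]_n) \sum_(y3 : 'M[F]_n) k1 x y1 * k2 y1 y2 * k1 y2 y3 * k2 y3 z) * phi z)) => [|y1 _].
    rewrite -mulr_sumr mulrA -exprS; congr (_ * _); rewrite exchange_big; apply: eq_bigr => z _ /=.
    by rewrite mulr_suml.
  rewrite e2 mulrCA mulr_sumr; congr (_ * _); apply: eq_bigr => z _; rewrite mulrA; congr (_ * _).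
  rewrite mulr_sumr; apply: eq_bigr => y2 _; rewrite mulr_sumr; apply: eq_bigr => y3 _.
  by rewrite !mulrA.
have cnt z : \sum_(y1 : 'M[F]_n) \sum_(y2 : 'M[F]_n) \sum_(y3 : 'M[F]_n) k1 x y1 * k2 y1 y2 * k1 y2 y3 * k2 y3 z <=
    kern (~: [set i; j]) x z * (2 * q ^ (2 * m + 1))%:R.
  rewrite /k1 /k2 /kern; case zS : (z \in SL); last first.
    by rewrite mul0r big1 // => y1 _; rewrite big1 // => y2 _; rewrite big1 // => y3 _; rewrite mulr0.
  rewrite -natrM; have := card_four_step z ij (eqP (etrans (esym (inSLn x)) xS)).
  rewrite -(ler_nat algC) => /(le_trans _); apply.
  rewrite pair_big pair_big /= -sum1_card natr_sum [X in _ <= X]big_mkcond /=.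
  apply: ler_sum => -[[y1 y2] y3] _; rewrite [X in if X then _ else _]inE /= -!natrM !mulnb.
  case: (y1 \in SL); case: (y2 \in SL); case: (y3 \in SL); rewrite /= ?andbF /= ?andbF //=.
  by rewrite -!andbA; case: ifP.
apply: le_trans (_ : Q ^+ 4 * \sum_(z : 'M[F]_n) (kern (~: [set i; j]) x z * (2 * q ^ (2 * m + 1))%:R) * phi z <= _).
  apply: ler_wpM2l; first by rewrite exprn_ge0 // invr_ge0 exprn_ge0 // ler0n.
  by apply: ler_sum => z _; apply: ler_wpM2r.
rewrite le_eqVlt; apply/orP; left; apply/eqP; rewrite avgE c2.
rewrite (eq_bigr (fun z => (2 * q ^ (2 * m + 1))%:R * (kern (~: [set i; j]) x z * phi z))) => [|z _]; last first.
  by rewrite mulrAC mulrC.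
rewrite -mulr_sumr !mulrA; congr (_ * _); rewrite natrM natrX.
rewrite mulrCA; congr (_ * _).
have hm : (m.+2 - m = 2)%N by lia.
have -> : (m.+2 * (m.+2 - m) - 1 = 2 * m + 3)%N by rewrite hm; lia.
have e : (m.+1 * 4 = (2 * m + 3) + (2 * m + 1))%N by lia.
by rewrite /Q exprVn -exprM e exprD invfM -mulrA mulVf ?mulr1 ?qk_neq0.
Qed.
End FourStepDomination.

(** Induction on the number [k] of free rows beyond the first. Reaching two free rows takes four
    steps; from three on, a row outside [i], [j] absorbs the determinant condition and two steps
    suffice. Since [K] is chosen before [F], it is uniform in [q]. *)
Lemma good_avg (m k : nat) : (1 < m)%N -> exists K, forall (F : finFieldType) (J : {set 'I_m.+1}),
  (#|J| + k = m)%N -> good (@avg F m J) K.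
Proof.
move=> m1; elim: k => [|k [K IH]].
  exists 1%N => F J; rewrite addn0 => cJ.
  have /eqP/cards1P[i hi] : #|~: J| = 1%N by rewrite cardsCs setCK card_ord cJ subSnn.
  by rewrite -[J]setCK hi; apply: good_base.
have two (F : finFieldType) (J : {set 'I_m.+1}) : (#|J| + k.+1 = m)%N ->
    exists i j, [/\ i \notin J, j \notin J & i != j].
  move=> cJ; have /card_gt1P[i [j [hi hj ij]]] : (1 < #|~: J|)%N.
    rewrite -(leq_add2l #|J|) cardsC card_ord.
    by apply: leq_trans (_ : (#|J| + k.+1).+1 <= _)%N; [rewrite -addnS leq_add2l|rewrite cJ].
  by move: hi hj; rewrite !inE => hi hj; exists i, j.
case: k IH two => [|k] IH two.
  exists (K * K.+1 * (K * K.+1).+1 * 2 ^ 2)%N => F J cJ.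
  have [i [j [iJ jJ ij]]] := two F J cJ.
  case: m m1 IH two J cJ i j iJ jJ ij => // m m1 IH two J cJ i j iJ jJ ij.
  have gi (a : 'I_m.+2) : good (@avg F m.+1 (~: [set a])) K.
    by apply: IH; rewrite cardsCs setCK card_ord cards1; lia.
  have eJ : J = ~: [set i; j].
    apply/eqP; rewrite eqEcard; apply/andP; split.
      by apply/subsetP => a aJ; rewrite !inE negb_or; apply/andP; split;
         apply: contraTneq aJ => ->.
    by rewrite cardsCs setCK card_ord cards2 ij; lia.
  have g2 := good_comp (gi i) (gi j); have g4 := good_comp g2 g2.
  apply: (good_avg_dominated g4); rewrite ?cards1 //; first by lia.
  by move=> phi p0 x xS; rewrite eJ; apply: avg_four_step.
exists (K * K.+1 * 1 ^ 2)%N => F J cJ.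
have [i [j [iJ jJ ij]]] := two F J cJ.
have gi (a : 'I_m.+1) : a \notin J -> good (@avg F m (a |: J)) K.
  by move=> aJ; apply: IH; rewrite cardsU1 aJ; exact: (etrans (addSnnS _ _) cJ).
apply: (good_avg_dominated (good_comp (gi i iJ) (gi j jJ))) => //; first by lia.
by move=> phi p0 x xS; apply: avg_two_step => //; lia.
Qed.

Lemma energy_le_mean (m : nat) : (1 < m)%N -> exists K : nat,
  forall (F : finFieldType) (phi f : 'M[F]_m.+1 -> algC), nonneg phi -> nonneg f ->
  energy phi f <= K%:R * (energy (avg set0 phi) f + gap F m * sqnorm phi * l2norm f).
Proof.
move=> m1; have [K hK] := good_avg m m1; exists K => F phi f p0 f0.
by have [|_ _] := hK F set0; [rewrite cards0|apply].
Qed.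

(** * The expander *)

(** If [a > 2 * y] then [a - y > a / 2], so [a ^ 2 / 4 <= M * a]. *)
Lemma le_of_sqr_sub_le (R : realDomainType) (a y M : R) :
  0 <= a -> 0 <= y -> 0 <= M -> (a - y) ^+ 2 <= M * a -> a <= 2 * y + 4 * M.
Proof.
move=> a0 y0 M0 h; have [|lt] := leP a (2 * y); first by move=> ?; lra.
suff : a <= 4 * M by lra.
have [|ap] := leP a 0; first by lra.
by rewrite -(ler_pM2r ap); nra.
Qed.

(** * Additive energy and determinant energy of a pair of sets *)

Section Sums.
Variables (F : finFieldType) (m : nat).
Local Notation n := m.+1.
Local Notation q := (#|F|).
Local Notation k := (#|F|.-1).
Local Notation SL := (SLn F n).
Variables (B C : {set 'M[F]_n}).

Definition add_rep (d : 'M[F]_n) : nat := (\sum_(b in B) \sum_(c in C) (b + c == d)%R)%N.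
Definition det_rep (t : F) : nat := (\sum_(b in B) \sum_(c in C) (\det (b + c)%R == t))%N.
Definition add_energy : nat := (\sum_d add_rep d ^ 2)%N.
Definition det_energy : nat := (\sum_(t | t != 0%R) det_rep t ^ 2)%N.
Definition unit_pairs : nat := (\sum_(b in B) \sum_(c in C) (\det (b + c)%R != 0%R))%N.

Lemma sum_delta (I : finType) (a : I) (g : I -> nat) : (\sum_i (a == i) * g i = g a)%N.
Proof.
rewrite (bigD1 a) //= eqxx mul1n big1 ?addn0 // => i ia.
by rewrite eq_sym (negPf ia).
Qed.

Lemma sum_rep (g : 'M[F]_n -> nat) :
  (\sum_d add_rep d * g d = \sum_(b in B) \sum_(c in C) g (b + c)%R)%N.
Proof.
rewrite (eq_bigr (fun d => \sum_(b in B) \sum_(c in C) (b + c == d)%R * g d)%N) => [|d _].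
  rewrite exchange_big; apply: eq_bigr => b _; rewrite exchange_big; apply: eq_bigr => c _.
  exact: sum_delta.
by rewrite big_distrl; apply: eq_bigr => b _; rewrite big_distrl.
Qed.

Lemma sum_detrep (g : F -> nat) :
  (\sum_t det_rep t * g t = \sum_(b in B) \sum_(c in C) g (\det (b + c)%R))%N.
Proof.
rewrite (eq_bigr (fun t => \sum_(b in B) \sum_(c in C) (\det (b + c)%R == t) * g t)%N) => [|d _].
  rewrite exchange_big; apply: eq_bigr => b _; rewrite exchange_big; apply: eq_bigr => c _.
  exact: sum_delta.
by rewrite big_distrl; apply: eq_bigr => b _; rewrite big_distrl.
Qed.

Lemma sum_detrep_units : (\sum_(t | t != 0%R) det_rep t = unit_pairs)%N.
Proof.
rewrite /unit_pairs -(sum_detrep (fun t => (t != 0%R) : nat)) big_mkcond /=.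
by apply: eq_bigr => t _; case: (t != 0); rewrite ?muln1 ?muln0.
Qed.

Lemma sum_indicator_sqr (I : finType) (D : {set I}) : (\sum_i (i \in D) ^ 2 = #|D|)%N.
Proof.
rewrite -sum1_card [RHS]big_mkcond; apply: eq_bigr => i _.
by case: (i \in D).
Qed.

(** Relaxing [d - c \in B] to [\det (d - c) = 1] bounds [add_rep d] by a determinant count. Mixing
    with weight [add_rep] then bounds the energy in terms of itself. *)
Lemma add_energy_le : B \subset SL ->
  (k * add_energy <= 2 * (#|B| * #|C| ^ 2) + 4 * (k * q ^ (n * n) * #|C|))%N.
Proof.
move=> BSL; have := @det_mixing_nat F n (fun t => (t == 1%R) : nat) add_rep (fun c => (c \in C) : nat) _ _ isT _ erefl erefl.
rewrite eq_sym (negPf (oner_neq0 F)) => /(_ erefl).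
have -> : (\sum_(t : F) (t == 1%R))%N = 1%N.
  by rewrite (bigD1 1) //= eqxx big1 ?addn0 // => t /negPf ->.
have -> : (\sum_(t : F) (t == 1%R) ^ 2)%N = 1%N.
  by rewrite (bigD1 1) //= eqxx big1 ?addn0 // => t /negPf ->.
rewrite sum_indicator_sqr mul1r -/add_energy muln1.
set X := (\sum_x \sum_y _)%N; set Y := (\sum_x \sum_y _)%N => h.
have hX : (add_energy <= X)%N.
  apply: leq_sum => d _; rewrite -mulnn.
  rewrite (eq_bigr (fun c => add_rep d * ((c \in C) * (\det (d - c)%R == 1%R)))%N) => [|c _]; last by rewrite mulnA.
  rewrite -big_distrr leq_mul2l; apply/orP; right; rewrite {1}/add_rep exchange_big big_mkcond /=.
  apply: leq_sum => c _; case: ifP => // _; rewrite mul1n.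
  case: (boolP (d - c \in B)) => [dB|ndB].
    move/subsetP/(_ _ dB): BSL; rewrite inSLn => ->.
    rewrite (bigD1 (d - c)) //= subrK eqxx big1 ?addn0 // => b /andP[_ nb].
    by apply/eqP; rewrite eqb0; apply: contra nb => /eqP <-; rewrite addrK.
  rewrite big1 // => b bB; case: eqP => // e; case/negP: ndB.
  by rewrite -e addrK.
have hY : (Y <= #|B| * #|C| ^ 2)%N.
  apply: leq_trans (_ : \sum_d add_rep d * #|C| <= _)%N.
    apply: leq_sum => d _; rewrite -sum1_card big_distrr /= [X in (_ <= X)%N]big_mkcond.
    apply: leq_sum => c _; case: (c \in C); last by rewrite muln0.
    by rewrite !muln1 -[X in (_ <= X)%N]muln1 leq_mul2l leq_b1 orbT.
  by rewrite sum_rep !sum_nat_const mulnA.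
have : k%:Z * X%:Z <= 2 * Y%:Z + 4 * (k * q ^ (n * n) * #|C|)%N%:Z.
  apply: le_of_sqr_sub_le => //; apply: le_trans h _.
  rewrite -!PoszM lez_nat.
  apply: leq_trans (_ : (k * q ^ (n * n) * #|C|) * (k * add_energy) <= _)%N.
    by rewrite eq_leq //; ring.
  by rewrite !leq_mul2l hX !orbT.
have : (k * add_energy <= k * X)%N by rewrite leq_mul2l hX orbT.
move: hY; set bb := (#|B| * _)%N; set cc := (_ * #|C|)%N; set e := (k * add_energy)%N.
by rewrite -PoszM; lia.
Qed.

(** With [gam] equal to [det_rep] off 0, both the mixed sum and the second moment of [gam] are
    [det_energy]. The set [C] is negated because mixing is stated for differences. *)
Lemma det_energy_le :
  (k * det_energy <= 2 * unit_pairs ^ 2 + 4 * (k * q ^ (n * n) * (#|B| * #|C|)))%N.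
Proof.
pose gam (t : F) := if t == 0 then 0%N else det_rep t.
have := @det_mixing_nat F n gam (fun b => (b \in B) : nat) (fun c => (- c \in C) : nat) _ _ isT _ erefl erefl.
rewrite {1}/gam eqxx => /(_ erefl).
have tr (g : F -> nat) : (\sum_x \sum_y (x \in B) * (- y \in C) * g (\det (x - y)%R) =
    \sum_(b in B) \sum_(c in C) g (\det (b + c)%R))%N.
  rewrite [RHS]big_mkcond; apply: eq_bigr => b _; case: ifP => _; last first.
    by rewrite big1 // => y _; rewrite !mul0n.
  rewrite (reindex_inj (@oppr_inj _)) [RHS]big_mkcond; apply: eq_bigr => c _.
  by rewrite mul1n !opprK; case: ifP; rewrite ?mul1n ?mul0n.
rewrite !(tr gam) !(tr (fun t => (t != 0%R) : nat)) -/unit_pairs -(sum_detrep gam).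
have -> : (\sum_t det_rep t * gam t)%N = det_energy.
  rewrite /det_energy [RHS]big_mkcond; apply: eq_bigr => t _; rewrite /gam.
  by case: eqP; rewrite ?muln0 ?mulnn.
have -> : (\sum_t gam t ^ 2)%N = det_energy.
  rewrite /det_energy [RHS]big_mkcond; apply: eq_bigr => t _; rewrite /gam.
  by case: eqP.
have -> : (\sum_t gam t)%N = unit_pairs.
  rewrite -sum_detrep_units [RHS]big_mkcond; apply: eq_bigr => t _; rewrite /gam.
  by case: eqP.
have -> : (\sum_x (- x \in C) ^ 2)%N = #|C|.
  by rewrite (reindex_inj (@oppr_inj _)) -sum_indicator_sqr; apply: eq_bigr => c _; rewrite opprK.
rewrite sum_indicator_sqr => h.
have : k%:Z * det_energy%:Z <= 2 * (unit_pairs%:Z * unit_pairs%:Z) + 4 * (k * q ^ (n * n) * (#|B| * #|C|))%N%:Z.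
  apply: le_of_sqr_sub_le => //; apply: le_trans h _.
  rewrite -!PoszM lez_nat eq_leq //; ring.
by rewrite -!PoszM -mulnn; lia.
Qed.

End Sums.

Lemma card_SLn_le (F : finFieldType) m : (#|SLn F m.+1| <= #|F| ^ (m.+1 * m.+1 - 1))%N.
Proof.
have := @card_completions F m set0 1%:M; rewrite cards0 subn0 => /(_ isT).
apply: leq_trans; apply: subset_leq_card; apply/subsetP => x xS.
by rewrite inE xS; apply/agreeP => i; rewrite inE.
Qed.

(** * From the image to the energies *)

Section Expander.
Variables (F : finFieldType) (m : nat).
Local Notation n := m.+1.
Local Notation q := (#|F|).
Local Notation k := (#|F|.-1).
Local Notation SL := (SLn F n).
Variables (A B C : {set 'M[F]_n}).
Hypothesis m0 : (0 < m)%N.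
Hypothesis ASL : A \subset SL.
Hypothesis BSL : B \subset SL.
Local Notation rep := (add_rep B C).
Local Notation detrep := (det_rep B C).
Local Notation P := (unit_pairs B C).

Lemma unit_pairs_ge : (k * (#|B| * #|C|) <= k * P + #|C| * #|SL|)%N.
Proof.
have -> : (#|B| * #|C| = P + \sum_(c in C) \sum_(b in B) (\det (b + c)%R == 0%R))%N.
  rewrite [X in (_ + X)%N]exchange_big -big_split /=.
  rewrite (eq_bigr (fun=> #|C|)) ?sum_nat_const // => b _.
  rewrite -big_split /= (eq_bigr (fun=> 1%N)) ?sum1_card // => c _.
  by case: eqP.
rewrite mulnDr leq_add2l big_distrr -sum_nat_const /=; apply: leq_sum => c _.
apply: leq_trans (card_singular_translate c m0); rewrite leq_mul2l; apply/orP; right.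
rewrite -sum1_card big_mkcond [X in (_ <= X)%N]big_mkcond; apply: leq_sum => b _.
rewrite inE; case: ifP => // /(subsetP BSL) ->.
by case: eqP.
Qed.

Let urep d := (rep d * (\det d != 0%R))%N.
Let fiber s := (\sum_(a in A) urep (invmx a *m s))%N.
(** In [fiber] the inverse of [a] multiplies [s] on the left, whereas [inner] multiplies [h] on the
    right; transposition exchanges the sides. *)
Let phi (x : 'M[F]_n) : algC := ((invmx x)^T \in A)%:R.
Let psi (d : 'M[F]_n) : algC := (urep d^T)%:R.

Lemma sum_urep : (\sum_d urep d = P)%N.
Proof. exact: sum_rep. Qed.

Lemma unitSL x : x \in SL -> x \in unitmx.
Proof. by rewrite inSLn unitmxE => /eqP ->; rewrite unitr1. Qed.

Lemma invtr_inj : injective (fun x : 'M[F]_n => (invmx x)^T).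
Proof. by apply: (can_inj (g := fun x => (invmx x)^T)) => x; rewrite -trmx_inv trmxK invmxK. Qed.

Lemma invtr_SL x : ((invmx x)^T \in SL) = (x \in SL).
Proof. by rewrite !inSLn det_tr det_inv invr_eq1. Qed.

Lemma inner_fiber h : inner phi psi h = (fiber h^T)%:R.
Proof.
rewrite /inner (reindex_inj invtr_inj) /= natr_sum big_mkcond [RHS]big_mkcond.
apply: eq_bigr => a _; rewrite invtr_SL /phi /psi -trmx_inv trmxK invmxK trmx_mul trmxK.
case: ifP => aS; case: ifP => aA; rewrite ?mul1r ?mul0r //.
by rewrite (subsetP ASL _ aA) in aS.
Qed.

Lemma energy_fiber : energy phi psi = (\sum_s fiber s ^ 2)%:R.
Proof.
rewrite natr_sum [RHS](reindex_inj (@trmx_inj F n n)); apply: eq_bigr => h _.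
by rewrite inner_fiber normr_nat natrX.
Qed.

Lemma sum_fiber : (\sum_s fiber s = #|A| * P)%N.
Proof.
rewrite exchange_big -sum_nat_const; apply: eq_bigr => a aA.
have ua := unitSL (subsetP ASL _ aA).
rewrite -sum_urep [RHS](reindex_inj (@mulmx_injl F n (invmx a) _)) //.
by rewrite -unitfE -unitmxE unitmx_inv.
Qed.

Lemma fiber_support s : s \notin fset_image A B C -> fiber s = 0%N.
Proof.
move=> ns; rewrite /fiber big1 // => a aA; rewrite /urep /add_rep.
rewrite big1 // => b bB; rewrite big1 // => c cC; case: eqP => // e.
case/negP: ns; apply/imsetP; exists (a, b, c); first by rewrite !inE /= aA bB cC.
by rewrite /Defs.f /= e mulKVmx // unitSL // (subsetP ASL).
Qed.

Lemma fiber_cauchy : ((#|A| * P) ^ 2 <= #|fset_image A B C| * \sum_s fiber s ^ 2)%N.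
Proof.
set S := fset_image _ _ _.
have := @cauchy_schwarz_real int _ (fun s : 'M[F]_n => (s \in S)%:R) (fun s => (fiber s)%:R).
have r (x : int) : x \is Num.real by apply: num_real.
move=> /(_ (fun=> r _) (fun=> r _)).
have -> : \sum_s (s \in S)%:R * (fiber s)%:R = (#|A| * P)%N%:R :> int.
  rewrite -sum_fiber natr_sum; apply: eq_bigr => s _.
  by case: (boolP (s \in S)) => [_|/fiber_support ->]; rewrite ?mul1r ?mulr0.
have -> : \sum_s (s \in S)%:R ^+ 2 = #|S|%:R :> int.
  by rewrite -[in RHS]sum_indicator_sqr natr_sum; apply: eq_bigr => s _; rewrite natrX.
have -> : \sum_s (fiber s)%:R ^+ 2 = (\sum_s fiber s ^ 2)%N%:R :> int.
  by rewrite natr_sum; apply: eq_bigr => s _; rewrite natrX.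
by rewrite -natrX -natrM ler_nat.
Qed.

Lemma sqnorm_phi : sqnorm phi = #|A|%:R.
Proof.
rewrite /sqnorm (reindex_inj invtr_inj) /= -sum1_card natr_sum big_mkcond [RHS]big_mkcond.
apply: eq_bigr => a _; rewrite invtr_SL /phi -trmx_inv trmxK invmxK normr_nat.
case: ifP => aS; case: ifP => aA; rewrite ?expr1n ?expr0n //.
by rewrite (subsetP ASL _ aA) in aS.
Qed.

Lemma sum_phi : \sum_(x in SL) phi x = #|A|%:R.
Proof.
rewrite -sqnorm_phi; apply: eq_bigr => x _; rewrite /phi normr_nat.
by case: (_ \in A); rewrite ?expr1n ?expr0n.
Qed.

Lemma l2norm_psi : l2norm psi <= (add_energy B C)%:R.
Proof.
rewrite /add_energy natr_sum [X in _ <= X](reindex_inj (@trmx_inj F n n)).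
apply: ler_sum => d _; rewrite /psi /urep normr_nat -natrX ler_nat leq_exp2r //.
by rewrite -[X in (_ <= X)%N]muln1 leq_mul2l leq_b1 orbT.
Qed.

(** For invertible [h], the products [h *m x] with [\det x = 1] are exactly the matrices of
    determinant [\det h]. *)
Lemma sum_psi_coset h : \sum_(x in SL) psi (h *m x) = (detrep (\det h) * (\det h != 0))%:R.
Proof.
case: (eqVneq (\det h) 0) => [e|nh].
  rewrite muln0 big1 // => x _; rewrite /psi /urep det_tr det_mulmx e mul0r eqxx muln0 //.
have -> : detrep (\det h) = (\sum_d rep d * (\det d == \det h)%R)%N by rewrite sum_rep.
rewrite muln1 natr_sum [RHS](reindex_inj (@trmx_inj F n n)) [RHS](reindex_inj (mulmx_injl nh)) /=.
rewrite big_mkcond; apply: eq_bigr => x _; rewrite inSLn /psi /urep det_tr det_mulmx.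
have -> : (\det h * \det x == \det h) = (\det x == 1).
  by rewrite -[X in _ == X]mulr1 (inj_eq (mulfI nh)).
by case: eqP => [->|_]; rewrite ?mulr1 ?nh ?muln1 ?muln0.
Qed.

(** [avg set0 phi] is a constant function, and each nonzero determinant is attained by [#|SL|]
    matrices [h]. *)
Lemma energy_mean : energy (avg set0 phi) psi =
  (q%:R ^- (n * n - 1) * #|A|%:R) ^+ 2 * (#|SL| * det_energy B C)%:R.
Proof.
set Q := q%:R ^- _; rewrite /energy.
have hin h : inner (avg set0 phi) psi h = Q * #|A|%:R * (detrep (\det h) * (\det h != 0))%:R.
  rewrite -sum_psi_coset /inner mulr_sumr; apply: eq_bigr => x _; congr (_ * _).
  rewrite /avg cards0 subn0 -/Q; congr (_ * _); rewrite -sum_phi; apply: eq_bigl => y.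
  by rewrite [agree _ _ _](introT (agreeP _ _ _)) ?andbT // => i; rewrite inE.
have Q0 : 0 <= Q * #|A|%:R by rewrite mulr_ge0 ?ler0n // invr_ge0 exprn_ge0 // ler0n.
rewrite (eq_bigr (fun h : 'M[F]_n => (Q * #|A|%:R) ^+ 2 *
    ((detrep (\det h) * (\det h != 0%R)) ^ 2)%N%:R)) => [|h _]; last first.
  by rewrite hin normrM exprMn normr_nat [`|Q * _|]ger0_norm // natrX.
rewrite -mulr_sumr; congr (_ * _).
rewrite (sum_by_value (fun h : 'M[F]_n => \det h) (fun t => ((detrep t * (t != 0%R)) ^ 2)%N%:R : algC)).
rewrite natrM natr_sum mulr_sumr [RHS]big_mkcond; apply: eq_bigr => t _.
case: (eqVneq t 0) => [_|nt]; first by rewrite muln0 mul0rn.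
by rewrite muln1 card_det_eq // mulr_natl.
Qed.

(** From [#|SL| <= q ^ (n * n - 1)] and [q ^ m <= 2 * (q ^ m - 1)]; the exponent is
    [2 * (n * n - 1) - m]. *)
Lemma gap_le : gap F m * q%:R ^+ (n * n - 1) <= 2 * q%:R ^+ (2 * (n * n) - n - 1).
Proof.
have q0 := q_gt0 F; have hm : 2 <= (q%:R ^+ m : algC).
  rewrite -natrX ler_nat; apply: leq_trans (_ : q ^ 1 <= _)%N; first by rewrite expn1 q_gt1.
  by rewrite leq_exp2l ?q_gt1.
have Q1 : 0 < (q%:R ^+ m - 1 : algC) by rewrite subr_gt0; apply: lt_le_trans hm; rewrite ltr1n.
rewrite /gap mulrAC ler_pdivrMr //.
apply: le_trans (_ : q%:R ^+ (n * n - 1) * q%:R ^+ (n * n - 1) <= _).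
  by apply: ler_wpM2r; rewrite ?exprn_ge0 ?ler0n // -natrX ler_nat card_SLn_le.
have e : (n * n - 1 + (n * n - 1) = (2 * (n * n) - n - 1) + m)%N.
  by rewrite !mulSn !mulnS; lia.
rewrite -exprD e exprD [2 * _]mulrC -mulrA; apply: ler_wpM2l; first by rewrite exprn_ge0 // ler0n.
rewrite mulrBr mulr1 mulr_natl mulr2n -addrA lerDl subr_ge0 //.
Qed.

(** Multiplying by [q ^ (n * n - 1)], an upper bound for [#|SL|], clears the denominators and
    reduces the mean term to [#|A| ^ 2 * det_energy]. *)
Lemma image_energy (K : nat) :
  (forall (phi psi : 'M[F]_n -> algC), nonneg phi -> nonneg psi ->
    energy phi psi <= K%:R * (energy (avg set0 phi) psi + gap F m * sqnorm phi * l2norm psi)) ->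
  (q ^ (n * n - 1) * (#|A| * P) ^ 2 <= #|fset_image A B C| *
    (K * (#|A| ^ 2 * det_energy B C + 2 * q ^ (2 * (n * n) - n - 1) * #|A| * add_energy B C)))%N.
Proof.
move=> /(_ phi psi (fun=> ler0n _ _) (fun=> ler0n _ _)).
rewrite energy_fiber energy_mean sqnorm_phi => h.
apply: leq_trans (leq_mul (leqnn _) fiber_cauchy) _; rewrite mulnCA leq_mul2l; apply/orP; right.
have q0 := q_gt0 F; set Q := (q%:R ^+ (n * n - 1) : algC) in h.
have Q0 : 0 < Q by rewrite exprn_gt0.
rewrite -(ler_nat algC) natrM natrX -/Q; apply: le_trans (ler_wpM2l (ltW Q0) h) _.
rewrite [X in _ <= X]natrM [X in X <= _]mulrCA; apply: ler_wpM2l; first exact: ler0n.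
rewrite [X in _ <= X]natrD [X in X <= _]mulrDr; apply: lerD.
  have -> : Q * ((Q^-1 * #|A|%:R) ^+ 2 * (#|SL| * det_energy B C)%:R) =
      (Q^-1 * #|SL|%:R) * (#|A| ^ 2 * det_energy B C)%:R.
    by rewrite !natrM; field; exact: lt0r_neq0.
  rewrite -[X in _ <= X]mul1r; apply: ler_wpM2r; first exact: ler0n.
  rewrite mulrC ler_pdivrMr // mul1r /Q -natrX ler_nat; exact: card_SLn_le.
have -> : Q * (gap F m * #|A|%:R * l2norm psi) = (gap F m * Q) * (#|A|%:R * l2norm psi) by ring.
have -> : (2 * q ^ (2 * (n * n) - n - 1) * #|A| * add_energy B C)%:R =
    (2 * q%:R ^+ (2 * (n * n) - n - 1)) * (#|A|%:R * (add_energy B C)%:R) :> algC.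
  by rewrite -natrX -!natrM !mulnA.
apply: ler_pM; [apply: mulr_ge0|apply: mulr_ge0|exact: gap_le|].
- exact: gap_ge0.
- exact: ltW.
- exact: ler0n.
- exact: l2norm_ge0.
by apply: ler_wpM2l; [exact: ler0n|exact: l2norm_psi].
Qed.
End Expander.

(** * Numerical conclusion *)

Lemma unit_pairs_le (F : finFieldType) m (B C : {set 'M[F]_m.+1}) :
  (unit_pairs B C <= #|B| * #|C|)%N.
Proof.
rewrite -sum_nat_const; apply: leq_sum => b _; rewrite -sum1_card; apply: leq_sum => c _.
exact: leq_b1.
Qed.

(* [W] stands for [q ^ (n ^ 2 - 2)], [V] for [q ^ (n - 1) ^ 2] and [E] for
   [q ^ (2 * n ^ 2 - n - 1)]. *)
Lemma counting_arith (K q k a b c s P T2 X2 sl W V E : nat) :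
  (2 < q)%N -> q = k.+1 -> (0 < a)%N -> (0 < W)%N -> (q ^ 3 <= V)%N ->
  (sl <= q * W)%N -> (3 * W <= b)%N -> (3 * V <= c)%N -> (P <= b * c)%N ->
  (k * (b * c) <= k * P + c * sl)%N ->
  (k * T2 <= 2 * (b * c ^ 2) + 4 * (k * (q ^ 2 * W) * c))%N ->
  (k * X2 <= 2 * P ^ 2 + 4 * (k * (q ^ 2 * W) * (b * c)))%N ->
  (q * W * (a * P) ^ 2 <= s * (K * (a ^ 2 * X2 + 2 * E * a * T2)))%N ->
  (q ^ 2 * W * (a * b) <= 48 * K * s * (a * b + 2 * E))%N.
Proof.
move=> q3 qk a0 W0 hV hsl hb hc hPD hP hT hX hE.
have c0 : (0 < c)%N by apply: leq_trans hc; rewrite muln_gt0 /=; apply: leq_trans hV; rewrite expn_gt0; lia.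
have b0 : (0 < b)%N by apply: leq_trans hb; rewrite muln_gt0.
have k0 : (0 < k)%N by lia.
set D := (b * c)%N in hPD hP hX.
(* At least half of the pairs have an invertible sum: [q >= 3] gives [2 * q <= 3 * k], so
   [3 * W <= b] makes the singular pairs at most [D / 2]. *)
have hPD2 : (D <= 2 * P)%N.
  have h1 : (2 * (q * W) <= k * b)%N.
    apply: leq_trans (_ : k * (3 * W) <= _)%N; last by rewrite leq_mul2l hb orbT.
    by rewrite !mulnA leq_mul2r; apply/orP; right; lia.
  have h2 : (2 * (c * sl) <= k * D)%N.
    apply: leq_trans (_ : c * (2 * (q * W)) <= _)%N.
      by rewrite mulnCA leq_mul2l leq_mul2l hsl !orbT.
    have -> : (k * D = c * (k * b))%N by rewrite /D; ring.
    by rewrite leq_mul2l h1 orbT.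
  by rewrite -(leq_pmul2l k0); lia.
(* The Fourier error terms are absorbed by the main terms. *)
have hD : (k * (q ^ 2 * W) <= D)%N.
  apply: leq_trans (_ : q ^ 3 * W <= _)%N.
    by rewrite mulnA expnS leq_mul2r leq_mul2r; apply/orP; right; apply/orP; right; lia.
  rewrite mulnC /D; apply: leq_mul; first by lia.
  by apply: leq_trans hV _; lia.
have hX' : (k * X2 <= 6 * D ^ 2)%N.
  apply: leq_trans hX _.
  have h1 : (P ^ 2 <= D ^ 2)%N by rewrite leq_exp2r.
  have h2 : (k * (q ^ 2 * W) * D <= D ^ 2)%N by rewrite -mulnn leq_mul2r hD orbT.
  lia.
have hT' : (k * T2 <= 6 * (D * c))%N.
  apply: leq_trans hT _.
  have h2 : (k * (q ^ 2 * W) * c <= D * c)%N by rewrite leq_mul2r hD orbT.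
  have -> : (b * c ^ 2 = D * c)%N by rewrite /D -mulnn mulnA.
  lia.
have hP4 : (D ^ 2 <= 4 * P ^ 2)%N by apply: leq_trans (_ : (2 * P) ^ 2 <= _)%N; [rewrite leq_exp2r|rewrite expnMn].
(* Here [48 = 2 * 4 * 6]: the factors come from [q <= 2 * k], from [D ^ 2 <= 4 * P ^ 2], and from
   [6 = 2 + 4] in [hX'] and [hT']. *)
have main : (q ^ 2 * W * (a ^ 2 * D ^ 2) <= 48 * K * s * (a ^ 2 * D ^ 2 + 2 * E * a * (D * c)))%N.
  apply: leq_trans (_ : 8 * k * (q * W * (a * P) ^ 2) <= _)%N.
    rewrite expnMn; have -> : (8 * k * (q * W * (a ^ 2 * P ^ 2)) = (2 * k * q * W) * (a ^ 2 * (4 * P ^ 2)))%N by ring.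
    apply: leq_mul; last by rewrite leq_mul2l hP4 orbT.
    by rewrite -mulnn !leq_mul2r; apply/orP; right; apply/orP; right; lia.
  apply: leq_trans (leq_mul (leqnn _) hE) _.
  have -> : (8 * k * (s * (K * (a ^ 2 * X2 + 2 * E * a * T2))) =
    8 * K * s * (a ^ 2 * (k * X2) + 2 * E * a * (k * T2)))%N by ring.
  have -> : (48 * K * s * (a ^ 2 * D ^ 2 + 2 * E * a * (D * c)) =
    8 * K * s * (a ^ 2 * (6 * D ^ 2) + 2 * E * a * (6 * (D * c))))%N by ring.
  rewrite leq_mul2l; apply/orP; right; apply: leq_add; rewrite leq_mul2l ?hX' ?hT' orbT //.
have z0 : (0 < a * b * c ^ 2)%N by rewrite !muln_gt0 a0 b0 c0.
rewrite -(leq_pmul2r z0).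
have -> : (q ^ 2 * W * (a * b) * (a * b * c ^ 2) = q ^ 2 * W * (a ^ 2 * D ^ 2))%N by rewrite /D; ring.
have -> : (48 * K * s * (a * b + 2 * E) * (a * b * c ^ 2) =
  48 * K * s * (a ^ 2 * D ^ 2 + 2 * E * a * (D * c)))%N by rewrite /D; ring.
exact: main.
Qed.

Lemma image_card (F : finFieldType) m K (A B C : {set 'M[F]_m.+1}) :
  (forall (phi f : 'M[F]_m.+1 -> algC), nonneg phi -> nonneg f ->
    energy phi f <= K%:R * (energy (avg set0 phi) f + gap F m * sqnorm phi * l2norm f)) ->
  (1 < m)%N -> (2 < #|F|)%N -> A \subset SLn F m.+1 -> B \subset SLn F m.+1 ->
  (0 < #|A|)%N ->
  (3 * #|F| ^ (m.+1 * m.+1 - 2) <= #|B|)%N -> (3 * #|F| ^ (m * m) <= #|C|)%N ->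
  (#|F| ^ (m.+1 * m.+1) * (#|A| * #|B|) <= 48 * K * #|fset_image A B C| *
    (#|A| * #|B| + 2 * #|F| ^ (2 * (m.+1 * m.+1) - m.+1 - 1)))%N.
Proof.
move=> hK m1 q3 ASL BSL a0 hB hC.
have m0 : (0 < m)%N by exact: ltnW.
have h1 : (m.+1 * m.+1 - 1 = (m.+1 * m.+1 - 2).+1)%N by rewrite !mulSn; lia.
have h2 : (m.+1 * m.+1 = 2 + (m.+1 * m.+1 - 2))%N by rewrite !mulSn; lia.
have hE := image_energy C m0 ASL BSL hK; rewrite h1 expnS in hE.
have hSL := card_SLn_le F m; rewrite h1 expnS in hSL.
have hT := @add_energy_le F m B C BSL; rewrite {1}h2 expnD in hT.
have hX := det_energy_le B C; rewrite {1}h2 expnD in hX.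
have e3 : (#|F| ^ (m.+1 * m.+1) = #|F| ^ 2 * #|F| ^ (m.+1 * m.+1 - 2))%N by rewrite -expnD -h2.
rewrite e3.
have q0 : (0 < #|F|)%N by exact: ltnW (q_gt1 F).
apply: (counting_arith q3 _ a0 _ _ hSL hB hC (unit_pairs_le B C) (unit_pairs_ge C m0 BSL) hT hX hE).
- by rewrite prednK.
- by rewrite expn_gt0 q0.
- by rewrite leq_exp2l ?q_gt1 //; nia.
Qed.

Theorem theorem1p6 (R : realType) (n : nat) (hn : (3 <= n)%N) :
  exists C0 c : R,
    0 < C0 /\ 0 < c /\
    forall (q : nat) (F : finFieldType) (A B C : {set 'M[F]_n}),
      #|F| = q -> odd q ->
      A \subset SLn F n -> B \subset SLn F n ->
      C0 * q%:R ^+ (n ^ 2 - 2)%N <= #|B|%:R ->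
      C0 * q%:R ^+ ((n - 1) ^ 2)%N <= #|C|%:R ->
      c * Num.min (q%:R ^+ (n ^ 2)%N)
            (Num.min
               (#|A|%:R * #|B|%:R ^+ 2 * #|C|%:R
                  / q%:R ^+ (3 * n ^ 2 - 3 * n - 2)%N)
               (#|A|%:R * #|B|%:R / q%:R ^+ (n ^ 2 - n - 1)%N))
        <= #|fset_image A B C|%:R.
Proof.
case: n hn => [//|m] m1; have [K hK] := energy_le_mean m1.
(* [144 = 48 * 3], as [#|A| * #|B| + 2 * q ^ E] is at most three times the larger of [#|A| * #|B|]
   and [q ^ E]; the successor keeps the constant positive if [K = 0]. *)
have L0 : 0 < (144 * K.+1)%:R :> R by rewrite ltr0n.
exists 3, (144 * K.+1)%:R^-1; split; first by rewrite ltr0n.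
split; first by rewrite invr_gt0.
move=> q F A B C <- oq ASL BSL; rewrite subn1 -!mulnn.
rewrite -!natrX -!natrM !ler_nat => hB hC.
rewrite mulrC ler_pdivrMr //.
set s := #|fset_image A B C|; set x1 := _%:R; set x2 := _ / _; set x3 := _ / _.
have q0 : (0 < #|F|)%N by exact: ltnW (q_gt1 F).
(* Oddness excludes [q = 2]. *)
have q3 : (2 < #|F|)%N.
  by have := q_gt1 F; rewrite leq_eqVlt => /orP[/eqP e|//]; rewrite -e in oq.
have [a0|a0] := posnP #|A|.
  apply: le_trans (_ : 0 <= _); last by rewrite mulr_ge0 ?ler0n.
  by rewrite !ge_min /x3 a0 mul0n mul0r lexx !orbT.
have key := image_card (hK F) m1 q3 ASL BSL a0 hB hC.
set E := (2 * (m.+1 * m.+1) - m.+1 - 1)%N in key.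
have eE : (E = (m.+1 * m.+1 - m.+1 - 1) + m.+1 * m.+1)%N by rewrite /E !mulSn; nia.
have hs : (144 * K * s <= s * (144 * K.+1))%N by rewrite mulnC leq_mul2l leq_mul2l leqnSn !orbT.
(* Above the threshold [q ^ E] the image has order [q ^ (n ^ 2)]. Below it the bound is
   [#|A| * #|B|] over [q ^ (n ^ 2 - n - 1)], by the splitting of the exponent in [eE]. *)
have [h|h] := leqP (#|F| ^ E) (#|A| * #|B|).
  apply: le_trans (_ : x1 <= _); first by rewrite ge_min lexx.
  rewrite -natrM ler_nat; apply: leq_trans hs.
  have b0 : (0 < #|A| * #|B|)%N by apply: leq_trans h; rewrite expn_gt0 q0.
  by rewrite -(leq_pmul2r b0); apply: leq_trans key _; rewrite -/s; nia.
apply: le_trans (_ : x3 <= _); first by rewrite !ge_min lexx !orbT.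
have Q0 (j : nat) : (0 < #|F| ^ j)%N by rewrite expn_gt0 q0.
rewrite /x3 ler_pdivrMr ?ltr0n // -!natrM ler_nat.
apply: leq_trans (_ : 144 * K * s * #|F| ^ (m.+1 * m.+1 - m.+1 - 1) <= _)%N; last first.
  by rewrite leq_mul2r hs orbT.
rewrite -(leq_pmul2l (Q0 (m.+1 * m.+1)%N)); apply: leq_trans key _; rewrite -/s.
apply: leq_trans (_ : 144 * K * s * #|F| ^ E <= _)%N; first by nia.
by rewrite eE expnD eq_leq //; ring.
Qed.
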